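(* Let $(G,X)$ be a pseudo-free and recurrent self-similar action (with $X$ finite and nonempty), let $P=X^*\bowtie G$, let $\mathcal{S}_P$ be the inverse semigroup associated to the LCM monoid $P$, and let $\mathcal{S}_{(G,X)}$ be the inverse semigroup $\{(\alpha,g,\beta):\alpha,\beta\in X^*,g\in G\}\cup\{0\}$. Let $\varphi:\mathcal{S}_P\to\mathcal{S}_{(G,X)}$ be the inverse semigroup homomorphism $\varphi([(\alpha,g)][(\gamma,1_G)]^*B_n)=(\alpha,g,\gamma)$, $\varphi(0)=0$. Identifying the tight spectra of $E(\mathcal{S}_P)$ and of $E(\mathcal{S}_{(G,X)})$ with $X^{\mathbb{N}}$, the map $\Phi:\mathcal{G}_{\mathrm{tight}}(\mathcal{S}_P)\to\mathcal{G}_{\mathrm{tight}}(\mathcal{S}_{(G,X)})$ defined by $$\Phi[s,x]=[\varphi(s),x],\qquad s\in\mathcal{S}_P,\ x\in D_{s^*s},$$ is an isomorphism of topological groupoids. In particular, $$\mathcal{Q}_{\mathrm{ts}}(P)\cong\mathcal{O}_{(G,X)}.$$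
   Context: Self-similar actions. $X^*$ is the free monoid of finite words over the finite nonempty alphabet $X$, $\epsilon$ the empty word, $|\alpha|$ the length of $\alpha$, $X^n$ the words of length $n$, $X^{\mathbb{N}}$ the infinite words. A self-similar action $(G,X)$ is a group $G$ acting faithfully on the left on $X^*$ by length-preserving bijections, $(g,\alpha)\mapsto g\cdot\alpha$, together with a restriction map $G\times X^*\to G$, $(g,\alpha)\mapsto g|_\alpha$, such that $g\cdot(\alpha\beta)=(g\cdot\alpha)(g|_\alpha\cdot\beta)$ for all $g,\alpha,\beta$. It is pseudo-free if $g\cdot\alpha=\alpha$ and $g|_\alpha=1_G$ for some $\alpha\in X^*$ implies $g=1_G$; it is recurrent if for all $h\in G$ and $\alpha,\beta\in X^*$ with $|\alpha|=|\beta|$ there is $g\in G$ with $g\cdot\alpha=\beta$ and $g|_\alpha=h$. The Zappa-Szép product $X^*\bowtie G$ is $X^*\times G$ with product $(\alpha,g)(\beta,h)=(\alpha(g\cdot\beta),g|_\beta h)$ and identity $1=(\epsilon,1_G)$; for pseudo-free $(G,X)$ it is a cancellative LCM monoid (for all $p,q\in P$, $pP\cap qP$ is empty or a principal right ideal, and $Pp\cap Pq$ is empty or a principal left ideal), with group of invertibles $U(P)=\{(\epsilon,g):g\in G\}$. $\mathcal{S}_P$. On $P\times P\times P$ put $(p,q,r)\sim(a,b,c)$ iff there are $u,v\in U(P)$ with $p=au$, $q=vbu$, $r=vc$; $[p,q,r]$ is the class. $\mathcal{S}_P=\{[p,q,r]: q\in rP\cap Pp\}\cup\{0\}$ is an inverse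 semigroup with $[p,q,r]^*=[r_1,q,p_1]$ where $q=rr_1=p_1p$, and $[p,q,r][a,b,c]=[pq_1,r_1raa_1,b_1c]$ if $raP\cap qP=kP$ with $raa_1=qq_1=k$ and $Pra\cap Pb=Pl$ with $r_1ra=b_1b=l$, and $0$ if one of these intersections is empty. Write $[p]:=[p,p,p]$, $A_\alpha:=[(\alpha,1_G),(\alpha,1_G),1]$ for $\alpha\in X^*$, and $B_n:=[1,(\beta,1_G),(\beta,1_G)]$ for any $\beta\in X^n$ (independent of $\beta$ when $(G,X)$ is recurrent). When $(G,X)$ is pseudo-free and recurrent, every nonzero element of $\mathcal{S}_P$ has the form $[(\alpha,g)][(\gamma,1_G)]^*B_n$ with $\alpha,\gamma\in X^*$, $g\in G$, $n\ge0$, where $(\alpha,g,\gamma)$ is determined by the element, and $E(\mathcal{S}_P)=\{A_\alpha B_n\}\cup\{0\}$. $\mathcal{S}_{(G,X)}$ has inverse $(\alpha,g,\beta)^*=(\beta,g^{-1},\alpha)$ and product $(\alpha,g,\gamma)(\delta,k,\sigma)$ equal to $(\alpha(g\cdot\gamma_1),g|_{\gamma_1},\sigma)$ if $\delta=\gamma\gamma_1$; $(\alpha,g(k^{-1}|_{\delta_1})^{-1},\sigma(k^{-1}\cdot\delta_1))$ if $\gamma=\delta\delta_1$; and $0$ if $\delta X^*\cap\gamma X^*=\emptyset$; products with $0$ are $0$. Its idempotents are $0$ and the $(\alpha,1_G,\alpha)$. Tight groupoids. For an inverse semigroup $S$ with zero and idempotent semilattice $E$, a filter in $E$ is a nonempty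 proper subset that is upwards closed and closed under products; the set of filters has the subspace topology from $\{0,1\}^E$; ultrafilters are maximal filters; the tight spectrum $\widehat E_{\mathrm{tight}}$ is the closure of the set of ultrafilters. $S$ acts on it by $D_e=\{\xi: e\in\xi\}$, $\alpha_s:D_{s^*s}\to D_{ss^*}$, $\alpha_s(\xi)=\{f\in E: f\geqslant ses^*\text{ for some }e\in\xi\}$. $\mathcal{G}_{\mathrm{tight}}(S)$ consists of classes $[s,x]$, $x\in D_{s^*s}$, with $[s,x]=[t,y]$ iff $x=y$ and $se=te$ for some $e\in E$ with $x\in D_e$; $d[s,x]=x$, $r[s,x]=\alpha_s(x)$, $[t,\alpha_s(x)][s,x]=[ts,x]$, $[s,x]^{-1}=[s^*,\alpha_s(x)]$; topology generated by $\{[s,x]:x\in U\}$, $U\subseteq D_{s^*s}$ open. The tight spectrum of $E(\mathcal{S}_P)$ is identified with $X^{\mathbb{N}}$ by letting $x=x_1x_2\cdots$ correspond to the ultrafilter $\{A_{x_1\cdots x_m}B_n: m,n\ge0\}$, and that of $E(\mathcal{S}_{(G,X)})$ by letting $x$ correspond to $\{(x_1\cdots x_m,1_G,x_1\cdots x_m): m\ge0\}$. In both cases the domain of the action of $[(\alpha,g)][(\gamma,1_G)]^*B_n$, respectively of $(\alpha,g,\gamma)$, is $\{\gamma x: x\in X^{\mathbb{N}}\}$, and it acts by $\gamma x\mapsto\alpha(g\cdot x)$. Algebras. $\mathcal{Q}_{\mathrm{ts}}(P):=C^*_{\mathrm{tight}}(\mathcal{S}_P)$, the universal C*-algebra for tight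 representations: a unital representation $\pi$ of the inverse monoid $S$ in a C*-algebra (multiplicative, $*$-preserving, $\pi(0)=0$) is tight if $\bigvee_{c\in C}\pi(c)=\pi(e)$ for each $e\in E$ and finite $C\subseteq E$ such that $c\leqslant e$ for all $c\in C$ and every nonzero $f\leqslant e$ has $cf\ne0$ for some $c\in C$. It is known that $C^*_{\mathrm{tight}}(S)\cong C^*(\mathcal{G}_{\mathrm{tight}}(S))$. $\mathcal{O}_{(G,X)}$ (Nekrashevych) is the universal C*-algebra for isometries $\{s_x:x\in X\}$ and unitaries $\{u_g:g\in G\}$ satisfying $\sum_{x\in X}s_xs_x^*=1$, $s_x^*s_y=0$ for $x\ne y$, $u_gu_h=u_{gh}$, $u_g^*=u_g^{-1}$, and $u_gs_x=s_{g\cdot x}u_{g|_x}$.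
   Formalization: In the product of S_(G,X), in the case δ=γγ₁, the middle entry is taken to be g|_{γ₁}k instead of the printed g|_{γ₁}, which drops k and conflicts with the second case when δ=γ. *)

(* Defs.v *)
From HB Require Import structures.
From mathcomp Require Import all_boot all_order all_algebra.
From mathcomp Require Import generic_quotient monoid.
From mathcomp Require Import all_classical all_reals all_analysis.
From mathcomp Require Import complex.

Set Implicit Arguments.
Unset Strict Implicit.
Unset Printing Implicit Defensive.

Import Order.TTheory GRing.Theory Num.Theory.
Import numFieldNormedType.Exports.
Local Open Scope classical_set_scope.

Record self_similar_action (G : groupType) (X : finType) := SelfSimilarAction {
  act : G -> seq X -> seq X;
  restr : G -> seq X -> G;
  act1 : forall al, act 1%g al = al;
  actM : forall g h al, act (g * h)%g al = act g (act h al);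
  act_size : forall g al, size (act g al) = size al;
  act_faithful : forall g, (forall al, act g al = al) -> g = 1%g;
  act_cat : forall g al be, act g (al ++ be) = act g al ++ act (restr g al) be
}.

Definition pseudo_free (G : groupType) (X : finType)
    (a : self_similar_action G X) : Prop :=
  forall g al, act a g al = al -> restr a g al = 1%g -> g = 1%g.

Definition recurrent (G : groupType) (X : finType)
    (a : self_similar_action G X) : Prop :=
  forall (h : G) (al be : seq X), size al = size be ->
    exists g : G, act a g al = be /\ restr a g al = h.

Definition zappa_szep (G : groupType) (X : finType)
  (a : self_similar_action G X) : Type := (seq X * G)%type.

Section ZappaSzep.
Variables (G : groupType) (X : finType) (a : self_similar_action G X).

Local Notation P := (zappa_szep a).

HB.instance Definition _ := Choice.copy P (seq X * G)%type.

Definition zs_mul (p q : P) : P :=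
  (p.1 ++ act a p.2 q.1, (restr a p.2 q.1 * q.2)%g).

Definition zs_one : P := ([::], 1%g).

Lemma act_inj g h : (forall al, act a g al = act a h al) -> g = h.
Proof.
move=> e; apply: (@mulIg _ h^-1%g); rewrite mulgV.
apply: (act_faithful (s := a)) => al.
by rewrite actM e -actM mulgV act1.
Qed.

Lemma act_nil g : act a g [::] = [::].
Proof. by apply/size0nil; rewrite act_size. Qed.

Lemma cat_injr (T : Type) (s t u : seq T) : s ++ t = s ++ u -> t = u.
Proof. by move=> /(congr1 (drop (size s))); rewrite !drop_size_cat. Qed.

Lemma restr_nil g : restr a g [::] = g.
Proof. by apply: act_inj => al; have := act_cat a g [::] al; rewrite act_nil. Qed.

Lemma restr1 al : restr a 1%g al = 1%g.
Proof.
apply: act_inj => be; have := act_cat a 1%g al be.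
by rewrite !act1 => /cat_injr <-.
Qed.

Lemma restr_cat g al be : restr a g (al ++ be) = restr a (restr a g al) be.
Proof.
apply: act_inj => c; have := act_cat a g (al ++ be) c.
by rewrite -catA !act_cat -!catA => /cat_injr /cat_injr <-.
Qed.

Lemma restrM g h al :
  restr a (g * h)%g al = (restr a g (act a h al) * restr a h al)%g.
Proof.
apply: act_inj => c; have := act_cat a (g * h)%g al c.
by rewrite !actM (act_cat a h) (act_cat a g) => /cat_injr <-.
Qed.

Lemma zs_mulA : associative zs_mul.
Proof.
move=> [al g] [be h] [c k]; rewrite /zs_mul /=; congr pair.
  by rewrite -catA act_cat actM.
by rewrite restr_cat restrM mulgA.
Qed.

Lemma zs_mul1 : left_id zs_one zs_mul.
Proof. by move=> [al g]; rewrite /zs_mul /= act1 restr1 mul1g. Qed.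

Lemma zs_mulr1 : right_id zs_one zs_mul.
Proof. by move=> [al g]; rewrite /zs_mul /= act_nil restr_nil cats0 mulg1. Qed.

HB.instance Definition _ := isMonoid.Build P zs_mulA zs_mul1 zs_mulr1.

End ZappaSzep.

(* Monoids with zero and involution.  Only the operations are recorded: the
   tight spectrum, the tight groupoid and the tight representations below are
   built from the operations alone, and are meant for inverse monoids with 0. *)

Record star_monoid0 := StarMonoid0 {
  sm_sort :> choiceType;
  sm_mul : sm_sort -> sm_sort -> sm_sort;
  sm_star : sm_sort -> sm_sort;
  sm_one : sm_sort;
  sm_zero : sm_sort
}.

Arguments sm_one {s}.
Arguments sm_zero {s}.

Notation "s '**' t" := (sm_mul s t) (at level 40, left associativity).
Notation "s '^*s'" := (sm_star s) (at level 2, format "s ^*s").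

Definition star_hom0 (S T : star_monoid0) (f : S -> T) : Prop :=
  [/\ forall s t, f (s ** t) = f s ** f t,
      forall s, f s^*s = (f s)^*s
    & f sm_zero = sm_zero].

(* The inverse semigroup S_P, meant for a cancellative LCM monoid P. *)

Section SP.
Variable P : monoidType.
Implicit Types p q r : P.

Definition right_ideal p : set P := [set (p * x)%g | x in setT].
Definition left_ideal p : set P := [set (x * p)%g | x in setT].

Definition is_unit (u : P) : Prop := exists v, (u * v = 1 /\ v * u = 1)%g.

Definition sp_ok (t : P * P * P) : Prop :=
  let: (p, q, r) := t in (right_ideal r `&` left_ideal p) q.

Definition sp_triple : Type := {t : P * P * P | `[< sp_ok t >]}.

HB.instance Definition _ := Choice.on sp_triple.

Definition sp_rel (s t : P * P * P) : Prop :=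
  let: (p, q, r) := s in let: (a, b, c) := t in
  exists u v, [/\ is_unit u, is_unit v &
                  [/\ p = a * u, q = v * b * u & r = v * c]%g].

Definition sp_sim (s t : sp_triple) : bool := `[< sp_rel (val s) (val t) >].

Lemma is_unit1 : is_unit 1%g.
Proof. by exists 1%g; rewrite mulg1. Qed.

Lemma is_unitM u v : is_unit u -> is_unit v -> is_unit (u * v)%g.
Proof.
move=> [u' [e1 e2]] [v' [e3 e4]]; exists (v' * u')%g; split.
  by rewrite mulgA -(mulgA u) e3 mulg1.
by rewrite mulgA -(mulgA v') e2 mulg1.
Qed.

Lemma sp_sim_refl : reflexive sp_sim.
Proof.
move=> s; apply/asboolP; case: (val s) => [[p q] r]; exists 1%g, 1%g.
by split; [exact: is_unit1|exact: is_unit1|rewrite !mulg1 !mul1g].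
Qed.

Lemma sp_simW s t : sp_sim s t -> sp_sim t s.
Proof.
move=> /asboolP st; apply/asboolP; move: st.
case: (val s) (val t) => [[p q] r] [[a b] c] [u] [v] [[u' [e1 e2]]].
move=> [v' [e3 e4]] [-> -> ->]; exists u', v'; split.
- by exists u.
- by exists v.
- by rewrite -!mulgA e1 !mulg1 !mulgA e4 !mul1g.
Qed.

Lemma sp_sim_sym : symmetric sp_sim.
Proof. by move=> s t; apply/idP/idP; exact: sp_simW. Qed.

Lemma sp_sim_trans : transitive sp_sim.
Proof.
move=> y x z /asboolP xy /asboolP yz; apply/asboolP; move: xy yz.
case: (val x) (val y) (val z) => [[p q] r] [[a b] c] [[k l] m].
move=> [u] [v] [uu uv [-> -> ->]] [u'] [v'] [uu' uv' [-> -> ->]].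
exists (u' * u)%g, (v * v')%g; split; [exact: is_unitM|exact: is_unitM|].
by rewrite !mulgA.
Qed.

Canonical sp_equiv :=
  EquivRel sp_sim sp_sim_refl sp_sim_sym sp_sim_trans.

(* [None] is the zero of S_P. *)
Definition sp_sort : Type := option {eq_quot sp_equiv}%qT.

HB.instance Definition _ := Choice.on sp_sort.

(* The class [p, q, r]; the junk value 0 if q is not in rP `&` Pp. *)
Definition sp_class p q r : sp_sort :=
  omap \pi_({eq_quot sp_equiv})%qT (insub (p, q, r)).

(* The product is given by its graph on representatives; it is 0 as soon as
   one factor is 0 or one of the two intersections is not principal (for an
   LCM monoid: is empty). *)
Definition sp_mul_graph (s t w : sp_sort) : Prop :=
  exists p q r a b c a1 q1 r1 b1 : P,
  [/\ sp_ok (p, q, r) /\ sp_ok (a, b, c),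
      s = sp_class p q r /\ t = sp_class a b c,
      exists k, right_ideal (r * a)%g `&` right_ideal q = right_ideal k
        /\ (r * a * a1 = k /\ q * q1 = k)%g,
      exists l, left_ideal (r * a)%g `&` left_ideal b = left_ideal l
        /\ (r1 * r * a = l /\ b1 * b = l)%g
    & w = sp_class (p * q1)%g (r1 * r * a * a1)%g (b1 * c)%g].

Definition sp_mul (s t : sp_sort) : sp_sort :=
  xget None [set w | sp_mul_graph s t w].

Definition sp_star_graph (s w : sp_sort) : Prop :=
  exists p q r p1 r1 : P,
  [/\ sp_ok (p, q, r), s = sp_class p q r,
      (q = r * r1 /\ q = p1 * p)%g & w = sp_class r1 q p1].

Definition sp_star (s : sp_sort) : sp_sort :=
  xget None [set w | sp_star_graph s w].

Definition S_P : star_monoid0 :=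
  @StarMonoid0 sp_sort sp_mul sp_star (sp_class 1%g 1%g 1%g) None.

Definition sp_elt p q r : S_P := sp_class p q r.
Definition sp_diag p : S_P := sp_class p p p.

End SP.

Section SelfSimilarSemigroups.
Variables (G : groupType) (X : finType) (a : self_similar_action G X).

Local Notation P := (zappa_szep a).

Definition zs (al : seq X) (g : G) : P := (al, g).

Definition sp_A (al : seq X) : S_P P := sp_elt (zs al 1%g) (zs al 1%g) 1%g.

(* [sp_B be] is the element B_n with n = size be. *)
Definition sp_B (be : seq X) : S_P P := sp_elt 1%g (zs be 1%g) (zs be 1%g).

(* [None] is the zero of S_(G,X). *)
Definition sgx_sort : Type := option (seq X * G * seq X).

HB.instance Definition _ := Choice.on sgx_sort.

Definition sgx_mul (s t : sgx_sort) : sgx_sort :=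
  if s is Some (al, g, ga) then
    if t is Some (de, k, si) then
      if prefix ga de then
        let ga1 := drop (size ga) de in
        Some (al ++ act a g ga1, (restr a g ga1 * k)%g, si)
      else if prefix de ga then
        let de1 := drop (size de) ga in
        Some (al, (g * (restr a k^-1 de1)^-1)%g, si ++ act a k^-1%g de1)
      else None
    else None
  else None.

Definition sgx_star (s : sgx_sort) : sgx_sort :=
  if s is Some (al, g, be) then Some (be, g^-1%g, al) else None.

Definition S_GX : star_monoid0 :=
  @StarMonoid0 sgx_sort sgx_mul sgx_star (Some ([::], 1%g, [::])) None.

Definition sgx (al : seq X) (g : G) (be : seq X) : S_GX := Some (al, g, be).

End SelfSimilarSemigroups.

(* Filters of idempotents and the tight spectrum.  A set of idempotents of S is
   encoded by its indicator function on S, which vanishes off E(S); thus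
   {0,1}^E is the closed subspace of {0,1}^S of functions supported in E. *)

Section TightSpectrum.
Variable S : star_monoid0.

Definition idem (e : S) : Prop := e ** e = e.

Definition idem_le (e f : S) : Prop := e ** f = e.

Definition idem_set : Type := {ptws S -> bool}.

HB.instance Definition _ := Topological.on idem_set.

Definition is_filter (xi : idem_set) : Prop :=
  [/\ forall e, xi e -> idem e,
      exists e, xi e,
      exists2 e, idem e & ~~ xi e,
      forall e f, xi e -> idem f -> idem_le e f -> xi f
    & forall e f, xi e -> xi f -> xi (e ** f)].

Definition is_ultrafilter (xi : idem_set) : Prop :=
  is_filter xi /\
  forall ze, is_filter ze -> (forall e, xi e -> ze e) -> ze = xi.

(* The closure of the set of ultrafilters in the space of filters. *)
Definition tight_spectrum : set idem_set :=
  [set xi | is_filter xi] `&` closure [set xi | is_ultrafilter xi].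

(* The map alpha_s, whose domain is D_e for e = s^* s. *)
Definition tight_act (s : S) (xi : idem_set) : idem_set :=
  fun f => `[< idem f /\ exists e, xi e /\ idem_le (s ** e ** s^*s) f >].

(* The pairs (s, xi) with xi in D_(s^* s). *)
Definition germ_dom (z : S * idem_set) : Prop :=
  tight_spectrum z.2 /\ z.2 (z.1^*s ** z.1).

(* The germ [s, xi], as an equivalence class of pairs. *)
Definition germ_class (z : S * idem_set) : set (S * idem_set) :=
  [set w | [/\ germ_dom w, w.2 = z.2 &
               exists e, [/\ idem e, z.2 e & z.1 ** e = w.1 ** e]]].

Definition tight_arrow : Type :=
  [set C | exists2 z, germ_dom z & C = germ_class z].

HB.instance Definition _ := Choice.on tight_arrow.

Definition is_germ (c : tight_arrow) (s : S) (xi : idem_set) : Prop :=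
  germ_dom (s, xi) /\ val c = germ_class (s, xi).

(* {[s, xi] : xi in U}; as U ranges over the open sets of the ambient space,
   its trace on D_(s^* s) ranges over the open subsets of D_(s^* s). *)
Definition germ_basic (s : S) (U : set idem_set) : set tight_arrow :=
  [set c | exists2 xi, U xi & is_germ c s xi].

Definition germ_subbase : set (set tight_arrow) :=
  [set B | exists s U, open U /\ B = germ_basic s U].

HB.instance Definition _ :=
  @isSubBaseTopological.Build tight_arrow (set tight_arrow) germ_subbase id.

(* A representative of a germ; source, range, product and inverse of germs do
   not depend on its choice when S is an inverse monoid. *)
Definition germ_repr (c : tight_arrow) : S * idem_set :=
  projT1 (cid2 (set_mem (valP c))).

Definition germ_src (c : tight_arrow) : idem_set := (germ_repr c).2.

Definition germ_rng (c : tight_arrow) : idem_set :=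
  tight_act (germ_repr c).1 (germ_repr c).2.

(* Meaningful when [germ_src b = germ_rng c]. *)
Definition germ_mul (b c : tight_arrow) : tight_arrow :=
  insubd c (germ_class ((germ_repr b).1 ** (germ_repr c).1, germ_src c)).

Definition germ_inv (c : tight_arrow) : tight_arrow :=
  insubd c (germ_class ((germ_repr c).1^*s, germ_rng c)).

End TightSpectrum.

Arguments tight_spectrum : clear implicits.

(* Structure maps of a topological groupoid; the product is only meaningful on
   pairs (b, c) with [tg_src b = tg_rng c]. *)
Record top_groupoid := TopGroupoid {
  tg_arrow :> topologicalType;
  tg_unit : Type;
  tg_src : tg_arrow -> tg_unit;
  tg_rng : tg_arrow -> tg_unit;
  tg_mul : tg_arrow -> tg_arrow -> tg_arrow;
  tg_inv : tg_arrow -> tg_arrow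
}.

Definition top_groupoid_iso (H K : top_groupoid) (F : H -> K) : Prop :=
  [/\ bijective F,
      continuous F /\ (forall U : set H, open U -> open (F @` U)),
      forall b c : H, tg_src b = tg_rng c <-> tg_src (F b) = tg_rng (F c),
      forall b c : H, tg_src b = tg_rng c ->
        F (tg_mul b c) = tg_mul (F b) (F c)
    & forall c : H, F (tg_inv c) = tg_inv (F c)].

Definition G_tight (S : star_monoid0) : top_groupoid :=
  @TopGroupoid (tight_arrow S) (idem_set S) (@germ_src S) (@germ_rng S)
    (@germ_mul S) (@germ_inv S).

(* T is homeomorphic via f to the subspace A of U. *)
Definition homeo_onto (T U : topologicalType) (f : T -> U) (A : set U) : Prop :=
  [/\ set_bij setT A f, continuous f
    & forall V : set T, open V -> exists2 W, open W & f @` V = W `&` A].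

Definition inf_word (X : finType) : Type := {ptws nat -> discrete_topology X}.

HB.instance Definition _ (X : finType) := Topological.on (inf_word X).

Section InfiniteWords.
Variables (G : groupType) (X : finType) (a : self_similar_action G X).

Definition word_prefix (x : inf_word X) (m : nat) : seq X := mkseq x m.

(* The filter {A_(x_1 ... x_m) B_n : m, n >= 0}. *)
Definition sp_point (x : inf_word X) : idem_set (S_P (zappa_szep a)) :=
  fun e => `[< exists m be, e = sp_A a (word_prefix x m) ** sp_B a be >].

Definition sgx_point (x : inf_word X) : idem_set (S_GX a) :=
  fun e => `[< exists m, e = sgx a (word_prefix x m) 1%g (word_prefix x m) >].

End InfiniteWords.

Arguments sp_point {G X} a x.
Arguments sgx_point {G X} a x.

(* Unital C*-algebras over K; the zero algebra is allowed.  The product is part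
   of the mixin because HB cannot join a ring structure with the norm of
   CompleteNormedModule (that join would have to precede numDomainType). *)

Local Open Scope ring_scope.

HB.mixin Record isCStarAlgebra (K : numClosedFieldType) A
    of CompleteNormedModule K A := {
  cmul : A -> A -> A;
  cone : A;
  cstar : A -> A;
  cmulA : associative cmul;
  cmul1l : left_id cone cmul;
  cmul1r : right_id cone cmul;
  cmulDl : left_distributive cmul +%R;
  cmulDr : right_distributive cmul +%R;
  cscaleAl : forall (k : K) (x y : A), k *: cmul x y = cmul (k *: x) y;
  cscaleAr : forall (k : K) (x y : A), k *: cmul x y = cmul x (k *: y);
  cstarD : forall x y : A, cstar (x + y) = cstar x + cstar y;
  cstarZ : forall (k : K) (x : A), cstar (k *: x) = k^* *: cstar x;
  cstarM : forall x y : A, cstar (cmul x y) = cmul (cstar y) (cstar x);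
  cstarK : involutive cstar;
  cnormM : forall x y : A, `|cmul x y| <= `|x| * `|y|;
  cnorm_star : forall x : A, `|cmul (cstar x) x| = `|x| ^+ 2
}.

#[short(type="cstarAlgType")]
HB.structure Definition CStarAlgebra (K : numClosedFieldType) :=
  {A of CompleteNormedModule K A & isCStarAlgebra K A}.

Notation "x '*c' y" := (cmul x y) (at level 40, left associativity).
Notation "x '^*c'" := (cstar x) (at level 2, format "x ^*c").
Notation "1c" := (@cone _ _).

Section CStar.
Variable K : numClosedFieldType.
Implicit Types A B : cstarAlgType K.

Definition star_morph A B (h : A -> B) : Prop :=
  [/\ forall (k : K) x y, h (k *: x + y) = k *: h x + h y,
      forall x y, h (x *c y) = h x *c h y,
      h 1c = 1c
    & forall x, h x^*c = (h x)^*c].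

Definition star_isomorphic A B : Prop :=
  exists2 h : A -> B, star_morph h & bijective h.

(* The join of commuting projections. *)
Definition proj_join A (p q : A) : A := p + q - p *c q.

Definition tight_cover (S : star_monoid0) (e : S) n (c : 'I_n -> S) : Prop :=
  (forall i, idem (c i) /\ idem_le (c i) e) /\
  forall f : S, idem f -> f <> sm_zero -> idem_le f e ->
    exists i, c i ** f <> sm_zero.

Definition tight_repr (S : star_monoid0) A (pi : S -> A) : Prop :=
  [/\ pi sm_one = 1c,
      forall s t, pi (s ** t) = pi s *c pi t,
      forall s, pi s^*s = (pi s)^*c,
      pi sm_zero = 0
    & forall (e : S) n (c : 'I_n -> S), idem e -> tight_cover e c ->
        \big[@proj_join A/0]_(i < n) pi (c i) = pi e].

(* (A, pi) is the universal C*-algebra for tight representations of S. *)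
Definition is_Cstar_tight (S : star_monoid0) A (pi : S -> A) : Prop :=
  tight_repr pi /\
  forall B (rho : S -> B), tight_repr rho ->
    exists! h : A -> B, star_morph h /\ forall s, h (pi s) = rho s.

(* In the last relation, y is the letter g . x. *)
Definition nekrashevych_family (G : groupType) (X : finType)
    (a : self_similar_action G X) A (s : X -> A) (u : G -> A) : Prop :=
  [/\ (forall x, (s x)^*c *c s x = 1c) /\
      (forall g, (u g)^*c *c u g = 1c /\ u g *c (u g)^*c = 1c),
      \sum_(x : X) s x *c (s x)^*c = 1c,
      forall x y, x != y -> (s x)^*c *c s y = 0,
      (forall g h, u g *c u h = u (g * h)%g) /\
      (forall g, (u g)^*c = u g^-1%g)
    & forall g x y, act a g [:: x] = [:: y] ->
        u g *c s x = s y *c u (restr a g [:: x])].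

(* (A, s, u) is the universal C*-algebra O_(G,X). *)
Definition is_O_GX (G : groupType) (X : finType)
    (a : self_similar_action G X) A (s : X -> A) (u : G -> A) : Prop :=
  nekrashevych_family a s u /\
  forall B (t : X -> B) (v : G -> B), nekrashevych_family a t v ->
    exists! h : A -> B,
      [/\ star_morph h, forall x, h (s x) = t x & forall g, h (u g) = v g].

End CStar.

(* Q_ts(P) is the universal C*-algebra for tight representations of S_P. *)
Definition is_Q_ts (K : numClosedFieldType) (P : monoidType)
    (A : cstarAlgType K) (pi : S_P P -> A) : Prop := is_Cstar_tight pi.

(* Main.v *)
Require Import Defs.
From mathcomp Require Import all_boot all_order all_algebra.
From mathcomp Require Import monoid.
From mathcomp Require Import all_classical all_reals all_analysis.
From mathcomp Require Import complex zify.

Set Implicit Arguments.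
Unset Strict Implicit.
Unset Printing Implicit Defensive.

Import GRing.Theory.

(* In S_P every nonzero element is [(al, g)][(ga, 1)]^* B_n for a unique
   (al, g, ga, n) with |al| <= n + |ga|; phi forgets n, and n only records the
   domain of a second action, by length shifts, on natural numbers.  Hence phi
   is idempotent pure, and phi u = phi v forces u B_n = v B_n for n large.  The
   tight filters of S_P are the pull-backs under phi of those of S_(G,X), so each
   of them contains every B_n: germs are insensitive to n, and Phi is an
   isomorphism.
   Likewise a tight representation sends every B_n to 1, so it factors through
   phi; and a tight representation of S_(G,X) is the same as a Nekrashevych
   family, via (al, g, ga) |-> s_al u_g s_ga^*. *)

Local Open Scope classical_set_scope.

(** Two features of the definitions shape the proof. The product and the involution of [S_P] are
    chosen from graphs on classes of triples, so not even associativity can be computed directly; it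
    becomes accessible once the product is known on normal forms, and the inverse monoid laws are
    then inherited from partial bijections. That one number n suffices in the normal form is due to
    recurrence: P p contains q as soon as |p| <= |q|, so the left ideals form a chain indexed by
    length and their intersections only produce maxima. Right ideals are governed by prefixes, as in
    [S_GX], which is why [sp_phi] is multiplicative. Finiteness of X enters twice. Closing up the
    set of ultrafilters adds nothing, since a limit must contain a word of every length. And a
    finite cover can be tested on words of one large length, whose projections sum to the projection
    that is covered. *)

(** * Inverse monoids and germs *)

Record inverse_monoid (S : star_monoid0) : Prop := InverseMonoid {
  im_mulA : forall s t u : S, s ** (t ** u) = s ** t ** u;
  im_mul1l : forall s : S, sm_one ** s = s;
  im_mul1r : forall s : S, s ** sm_one = s;
  im_mulsK : forall s : S, s ** s^*s ** s = s;
  im_starK : forall s : S, s^*s^*s = s;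
  im_starM : forall s t : S, (s ** t)^*s = t^*s ** s^*s;
  im_idemC : forall e f : S, idem e -> idem f -> e ** f = f ** e;
  im_idem_star : forall e : S, idem e -> e^*s = e
}.

(* A faithful representation by partial bijections, given by their graphs, is
   the cheapest way to the inverse monoid laws. *)
Record partial_bij_repr (S : star_monoid0) (Om : Type)
    (rho : S -> Om -> Om -> Prop) : Prop := PartialBijRepr {
  pb_inj : forall s t, (forall x y, rho s x y <-> rho t x y) -> s = t;
  pb_mul : forall s t x y, rho (s ** t) x y <-> exists2 z, rho t x z & rho s z y;
  pb_star : forall s x y, rho s^*s x y <-> rho s y x;
  pb_one : forall x y, rho sm_one x y <-> x = y;
  pb_fun : forall s x y z, rho s x y -> rho s x z -> y = z
}.

Section PartialBijRepr.
Variables (S : star_monoid0) (Om : Type) (rho : S -> Om -> Om -> Prop).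
Hypothesis rhoP : partial_bij_repr rho.

Lemma pb_fun_inv s x y z : rho s y x -> rho s z x -> y = z.
Proof. by move=> /(pb_star rhoP) h /(pb_star rhoP); exact: (pb_fun rhoP h). Qed.

(** Injectivity turns e(e x) = e x into e x = x. Commutation of idempotents then becomes the
    intersection of two partial identities. *)
Lemma pb_idemP e : idem e <-> forall x y, rho e x y -> x = y.
Proof.
split=> [ee x y exy|h].
  have := exy; rewrite -{1}ee => /(pb_mul rhoP)[z exz ezy].
  by rewrite (pb_fun_inv exy ezy); have -> := pb_fun rhoP exz exy.
apply: (pb_inj rhoP) => x y; rewrite (pb_mul rhoP).
split=> [[z exz ezy]|exy]; first by rewrite (h _ _ exz).
by exists y => //; rewrite -{1}(h _ _ exy).
Qed.

Lemma pb_inverse_monoid : inverse_monoid S.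
Proof.
have M := pb_mul rhoP; split.
- move=> s t u; apply: (pb_inj rhoP) => x y; rewrite !M; split.
    by move=> [z /M[w uw tw] sz]; exists w => //; apply/M; exists z.
  by move=> [w uw /M[z tz sz]]; exists z => //; apply/M; exists w.
- move=> s; apply: (pb_inj rhoP) => x y; rewrite !M; split.
    by move=> [z sz /(pb_one rhoP) <-].
  by exists y => //; apply/(pb_one rhoP).
- move=> s; apply: (pb_inj rhoP) => x y; rewrite !M; split.
    by move=> [z /(pb_one rhoP) <-].
  by exists x => //; apply/(pb_one rhoP).
- move=> s; apply: (pb_inj rhoP) => x y; rewrite !M; split.
    move=> [z sxz /M[w /(pb_star rhoP) swz swy]].
    by rewrite (pb_fun_inv sxz swz).
  by move=> sxy; exists y => //; apply/M; exists x => //; apply/(pb_star rhoP).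
- by move=> s; apply: (pb_inj rhoP) => x y; rewrite !(pb_star rhoP).
- move=> s t; apply: (pb_inj rhoP) => x y; rewrite (pb_star rhoP) !M.
  by split=> -[z h1 h2]; exists z => //; apply/(pb_star rhoP).
- move=> e f /pb_idemP he /pb_idemP hf.
  apply: (pb_inj rhoP) => x y; rewrite !M.
  by split=> -[z h1 h2];
    [move: (hf _ _ h1) (he _ _ h2)|move: (he _ _ h1) (hf _ _ h2)];
    move=> e1 e2; exists y => //; subst.
- move=> e /pb_idemP he; apply: (pb_inj rhoP) => x y; rewrite (pb_star rhoP).
  by split=> h; [move: (h); rewrite (he _ _ h)|move: (h); rewrite (he _ _ h)];
    move: h => /he <-.
Qed.

End PartialBijRepr.

Section InverseMonoid.
Variable S : star_monoid0.
Hypothesis invS : inverse_monoid S.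
Implicit Types (s t e f : S) (xi : idem_set S).

Let mulA := im_mulA invS.
Let idemC := im_idemC invS.

Lemma idem_starl s : idem (s^*s ** s).
Proof. by rewrite /idem mulA -(mulA s^*s) -mulA mulA -mulA (im_mulsK invS). Qed.

Lemma idem_starr s : idem (s ** s^*s).
Proof. by have := idem_starl s^*s; rewrite (im_starK invS). Qed.

Lemma mul_idem_starl s e : idem e -> s ** e = s ** e ** s^*s ** s.
Proof.
move=> ee; rewrite -{1}(im_mulsK invS s) -!mulA; congr (_ ** _).
by rewrite mulA (idemC (idem_starl s) ee).
Qed.

Lemma idem_mul e f : idem e -> idem f -> idem (e ** f).
Proof.
move=> ee ff; rewrite /idem -mulA (mulA f) (idemC ff ee) -mulA ff.
by rewrite mulA ee.
Qed.

Lemma idem_conj s e : idem e -> idem (s ** e ** s^*s).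
Proof.
move=> ee; rewrite /idem !mulA -(mul_idem_starl s ee).
by rewrite -(mulA s) ee.
Qed.

Lemma star_conj_conj s e : idem e ->
  s^*s ** (s ** e ** s^*s) ** s = s^*s ** s ** e.
Proof. by move=> ee; rewrite -!mulA; congr (_ ** _); rewrite !mulA -mul_idem_starl. Qed.

Lemma idem_le_conj s e f : idem e -> idem_le e f ->
  idem_le (s ** e ** s^*s) (s ** f ** s^*s).
Proof.
rewrite /idem_le => ee ef; rewrite !mulA -(mul_idem_starl s ee).
by rewrite -(mulA s) ef.
Qed.

Lemma idem_le_trans e f g : idem_le e f -> idem_le f g -> idem_le e g.
Proof. by rewrite /idem_le => <- fg; rewrite -mulA fg. Qed.

Lemma tight_is_filter xi : tight_spectrum S xi -> is_filter xi.
Proof. by case. Qed.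

(** The conjugates of the elements e f, with e in xi, already generate the image filter upwards, and
    [s] and [t] conjugate these alike. So the image depends on the germ only. *)
Lemma tight_act_congr s t xi f : is_filter xi -> xi f ->
  s ** f = t ** f -> tight_act s xi = tight_act t xi.
Proof.
move=> [id_xi _ _ up_xi mul_xi].
suff W s' t' : xi f -> s' ** f = t' ** f ->
    forall g, tight_act s' xi g -> tight_act t' xi g.
  by move=> xf st; apply/funext => g; apply/idP/idP; exact: W.
move=> xf st g /asboolP[ig [e [xe le_g]]]; apply/asboolP; split=> //.
have [ie if_] := (id_xi _ xe, id_xi _ xf).
exists (e ** f); split; first exact: mul_xi.
have E : t' ** (e ** f) ** t'^*s = s' ** (e ** f) ** s'^*s.
  rewrite (idemC ie if_) !mulA -st.
  have -> : s' ** f ** e = s' ** f ** e ** f.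
    by rewrite -mulA (idemC if_ ie) -mulA -mulA if_ (idemC ie if_).
  rewrite -!mulA; do 3! congr (_ ** _).
  have := congr1 (@sm_star S) st.
  by rewrite !(im_starM invS) (im_idem_star invS if_).
rewrite E; apply: idem_le_trans le_g; apply: idem_le_conj.
  exact: idem_mul.
by rewrite /idem_le -mulA (idemC if_ ie) mulA ie.
Qed.

End InverseMonoid.

(** * Germs computed from arbitrary representatives *)

Section Germs.
Variable S : star_monoid0.
Hypothesis invS : inverse_monoid S.
Hypothesis tight_act_tight : forall (s : S) xi,
  germ_dom (s, xi) -> tight_spectrum S (tight_act s xi).
Implicit Types (s t e f : S) (xi : idem_set S) (c : tight_arrow S).

Let mulA := im_mulA invS.
Let idemC := im_idemC invS.

Definition germ_rel xi s t : Prop := exists e, [/\ idem e, xi e & s ** e = t ** e].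

Lemma germ_rel_sym xi s t : germ_rel xi s t -> germ_rel xi t s.
Proof. by move=> [e [ie xe st]]; exists e. Qed.

Lemma germ_rel_refl xi s : is_filter xi -> germ_rel xi s s.
Proof. by move=> [id_xi [e xe] _ _ _]; exists e; split=> //; exact: id_xi. Qed.

Lemma germ_rel_trans xi s t u : is_filter xi ->
  germ_rel xi s t -> germ_rel xi t u -> germ_rel xi s u.
Proof.
move=> [_ _ _ _ mul_xi] [e [ie xe st]] [f [if_ xf tu]]; exists (e ** f).
split; [exact: idem_mul|exact: mul_xi|].
by rewrite mulA st -mulA (idemC ie if_) !mulA tu.
Qed.

Lemma germ_class_eq s t xi : germ_dom (s, xi) -> germ_dom (t, xi) ->
  germ_rel xi s t -> germ_class (s, xi) = germ_class (t, xi).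
Proof.
move=> ds dt st; have F := tight_is_filter ds.1.
apply/seteqP; split=> -[u eta] [/= du ex h]; rewrite ex in du *; split=> //.
  exact: (germ_rel_trans F (germ_rel_sym st)).
exact: (germ_rel_trans F st).
Qed.

Lemma is_germ_ex s xi : germ_dom (s, xi) -> exists c, is_germ c s xi.
Proof.
move=> d; have m : germ_class (s, xi) \in
    [set C | exists2 z, germ_dom z & C = germ_class z].
  by apply/mem_set; exists (s, xi).
by exists (exist (fun C => C \in _) _ m).
Qed.

Lemma is_germ_repr c : is_germ c (germ_repr c).1 (germ_repr c).2.
Proof.
rewrite /is_germ /germ_repr; case: (cid2 _) => /= -[s xi] d e.
by split.
Qed.

Lemma is_germ_inj c d s xi : is_germ c s xi -> is_germ d s xi -> c = d.
Proof. by move=> [_ cE] [_ dE]; apply/val_inj; rewrite cE dE. Qed.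

Lemma is_germ_rel c s t xi eta : is_germ c s xi -> is_germ c t eta ->
  eta = xi /\ germ_rel xi s t.
Proof.
move=> [ds cs] [dt ct].
have : germ_class (s, xi) (t, eta).
  by rewrite -cs ct; split=> //; apply: germ_rel_refl; case: dt => -[].
by move=> [_ /= -> h].
Qed.

Lemma is_germ_congr c s t xi : is_germ c s xi -> germ_dom (t, xi) ->
  germ_rel xi s t -> is_germ c t xi.
Proof. by move=> [ds cs] dt st; split=> //; rewrite cs; exact: germ_class_eq. Qed.

Lemma germ_srcE c s xi : is_germ c s xi -> germ_src c = xi.
Proof. by move=> /is_germ_rel /(_ (is_germ_repr c))[]. Qed.

Lemma germ_rngE c s xi : is_germ c s xi -> germ_rng c = tight_act s xi.
Proof.
move=> cs; have [e [f [if_ xf st]]] := is_germ_rel cs (is_germ_repr c).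
rewrite /germ_rng e; apply/esym/(tight_act_congr invS _ xf st).
by case: cs => -[/tight_is_filter].
Qed.

Lemma tight_act_conj s xi e : xi e -> idem e -> tight_act s xi (s ** e ** s^*s).
Proof.
move=> xe ie; have i := idem_conj invS s ie.
by apply/asboolP; split=> //; exists e.
Qed.

(** Some [s ** e ** s^*s] lies below the source idempotent of [t]. Conjugating it back by [s^*s]
    gives an element of xi below the source idempotent of [t ** s]. *)
Lemma germ_dom_mul s t xi : germ_dom (s, xi) -> germ_dom (t, tight_act s xi) ->
  germ_dom (t ** s, xi).
Proof.
move=> [/= T xs] [/= _ /asboolP[iF [e [xe le_t]]]].
have [id_xi _ _ up_xi mul_xi] := tight_is_filter T.
have ie := id_xi _ xe.
split=> //=; apply: (up_xi (s^*s ** s ** e)); first exact: mul_xi.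
  exact: idem_starl.
have := idem_le_conj invS s^*s (idem_conj invS s ie) le_t.
rewrite (im_starK invS) (star_conj_conj invS _ ie).
by rewrite (im_starM invS) !mulA.
Qed.

Lemma germ_rel_mul s s' t t' xi : is_filter xi ->
  germ_rel xi s s' -> germ_rel (tight_act s xi) t t' ->
  germ_rel xi (t ** s) (t' ** s').
Proof.
move=> F [f [if_ xf ss]] [g [ig /asboolP[_ [e [xe le_g]]] tt]].
have [id_xi _ _ up_xi mul_xi] := F; have ie := id_xi _ xe.
have tt' : t ** (s ** e ** s^*s) = t' ** (s ** e ** s^*s).
  have -> : s ** e ** s^*s = g ** (s ** e ** s^*s).
    by rewrite (idemC ig (idem_conj invS s ie)) le_g.
  by rewrite 2!mulA tt -!mulA.
exists (e ** f); split; [exact: idem_mul|exact: mul_xi|].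
have A u : u ** s ** (e ** f) = u ** (s ** e ** s^*s) ** s ** f.
  by rewrite -!mulA; congr (_ ** _); rewrite !mulA -mul_idem_starl.
rewrite A tt' -A (idemC ie if_) -!mulA; congr (_ ** _).
by rewrite !mulA ss.
Qed.

(** [germ_mul] is computed from chosen representatives, with [insubd] falling back on [c] for a set
    that is no germ. Here the fallback is excluded and any representatives may be used. *)
Lemma is_germ_mul b c s t xi :
  is_germ c s xi -> is_germ b t (tight_act s xi) ->
  is_germ (germ_mul b c) (t ** s) xi.
Proof.
move=> cs bt.
have [F ds dt] : [/\ is_filter xi, germ_dom (s, xi) & germ_dom (t, tight_act s xi)].
  by case: cs bt => ds _ [dt _]; split=> //; case: ds => -[].
have [e1 st1] := is_germ_rel cs (is_germ_repr c).
have [e2 st2] := is_germ_rel bt (is_germ_repr b).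
have [h1 _] := is_germ_repr c; have [h2 _] := is_germ_repr b.
have R := germ_rngE cs; rewrite /germ_rng e1 in R.
rewrite e1 in h1; rewrite e2 -R in h2.
have d := germ_dom_mul h1 h2.
apply: (@is_germ_congr _ ((germ_repr b).1 ** (germ_repr c).1)).
- split=> //; rewrite /germ_mul /germ_src e1 insubdK //.
  by apply/mem_set; exists ((germ_repr b).1 ** (germ_repr c).1, xi).
- exact: germ_dom_mul ds dt.
- exact/germ_rel_sym/(germ_rel_mul F st1 st2).
Qed.

Lemma germ_dom_star s xi : germ_dom (s, xi) -> germ_dom (s^*s, tight_act s xi).
Proof.
move=> ds; split; first exact: tight_act_tight.
have := tight_act_conj s ds.2 (idem_starl invS s).
by rewrite /= mulA (im_mulsK invS) (im_starK invS).
Qed.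

Lemma germ_rel_star s t xi : is_filter xi ->
  germ_rel xi s t -> germ_rel (tight_act s xi) s^*s t^*s.
Proof.
(* The idempotent on which [s] and [t] agree is transported to the range, where both conjugate it to
   the same element. *)
move=> F [f [if_ xf st]]; exists (s ** f ** s^*s); split.
- exact: idem_conj.
- exact: tight_act_conj.
have E : s ** f ** s^*s = t ** f ** t^*s.
  rewrite st; have := congr1 (@sm_star S) st.
  rewrite !(im_starM invS) (im_idem_star invS if_) => h.
  by rewrite -!mulA h.
have A u : u^*s ** (u ** f ** u^*s) = f ** u^*s.
  rewrite !mulA (idemC (idem_starl invS u) if_) -!mulA; congr (_ ** _).
  by have := im_mulsK invS u^*s; rewrite (im_starK invS) -mulA.
rewrite A E A; have := congr1 (@sm_star S) st.
by rewrite !(im_starM invS) (im_idem_star invS if_).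
Qed.

Lemma is_germ_inv c s xi : is_germ c s xi ->
  is_germ (germ_inv c) s^*s (tight_act s xi).
Proof.
move=> cs; have [ds _] := cs; have F := tight_is_filter ds.1.
have [e1 st] := is_germ_rel cs (is_germ_repr c).
have R := germ_rngE cs; have [h1 _] := is_germ_repr c.
have d := germ_dom_star h1; rewrite -/(germ_rng c) R in d.
apply: (@is_germ_congr _ (germ_repr c).1^*s).
- split=> //; rewrite /germ_inv R insubdK //.
  by apply/mem_set; exists ((germ_repr c).1^*s, tight_act s xi).
- exact: germ_dom_star.
- exact/germ_rel_sym/germ_rel_star.
Qed.

End Germs.

(** * Topology of germs, and the isomorphism criterion *)

Lemma near_ptws_eq (I : eqType) (D : discreteTopologicalType)
    (g : {ptws I -> D}) (i : I) : \forall h \near g, h i = g i.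
Proof.
have /(_ [set g i]) := @proj_continuous I (fun=> D) i g.
by apply; rewrite nbhs_principalE; apply/principal_filterP.
Qed.

Lemma continuous_ptws (T : topologicalType) (I : Type)
    (D : discreteTopologicalType) (f : T -> {ptws I -> D}) :
  (forall t i, \forall u \near t, f u i = f t i) -> continuous f.
Proof.
move=> h t; apply/cvg_sup => i A [B [[C oC <-] Cft] sBA].
by apply: filterS (h t i) => u e; apply: sBA; rewrite /= e.
Qed.

Lemma continuous_precomp (I J : eqType) (D : discreteTopologicalType)
    (k : J -> I) : continuous (fun g : {ptws I -> D} => g \o k : {ptws J -> D}).
Proof. by apply: continuous_ptws => g j; exact: near_ptws_eq. Qed.

(** The sets [germ_basic] are only declared as a subbase: an open set is a union of finite
    intersections of them, and preimages commute with both operations. *)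
Lemma continuous_germ (T : topologicalType) (S : star_monoid0)
    (f : T -> tight_arrow S) :
  (forall s (U : set (idem_set S)), open U -> open (f @^-1` germ_basic s U)) ->
  continuous f.
Proof.
move=> h; apply/continuousP => A [F sF <-].
rewrite preimage_bigcup; apply: bigcup_open => B /sF[E sE <-].
rewrite preimage_bigcap openE => t ft; rewrite /interior; apply: filter_bigI => C CE.
have /set_mem[s [U [oU CU]]] := sE _ CE.
have := h s U oU; rewrite -CU openE; apply; exact: ft.
Qed.

(** * Transfer of the tight groupoid along a homomorphism *)

Section GroupoidIso.
Variables (S T : star_monoid0) (phi : S -> T) (psi : T -> S).
Hypothesis invS : inverse_monoid S.
Hypothesis invT : inverse_monoid T.
Hypothesis phi_hom : star_hom0 phi.
Hypothesis psiK : cancel psi phi.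
Hypothesis idem_phi : forall e, idem (phi e) -> idem e.
Hypothesis ker_phi : forall u v, phi u = phi v ->
  exists b, [/\ idem b, phi b = sm_one & u ** b = v ** b].

Definition pull_idem (xi : idem_set T) : idem_set S := fun s => xi (phi s).

Hypothesis tight_pull : forall xi, tight_spectrum S xi <->
  exists2 eta, tight_spectrum T eta & xi = pull_idem eta.
Hypothesis tight_act_tightT : forall (t : T) xi,
  germ_dom (t, xi) -> tight_spectrum T (tight_act t xi).
Implicit Types (xi eta : idem_set T) (s t u v : S) (c : tight_arrow S).

Let phiM s t : phi (s ** t) = phi s ** phi t. Proof. by case: phi_hom. Qed.
Let phi_star s : phi s^*s = (phi s)^*s. Proof. by case: phi_hom. Qed.

Lemma pull_idem_inj : injective pull_idem.
Proof.
move=> xi eta e; apply/funext => t.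
by have := congr1 (fun f => f (psi t)) e; rewrite /pull_idem psiK.
Qed.

Lemma idem_phiE e : idem (phi e) <-> idem e.
Proof. by split; [exact: idem_phi|move=> h; rewrite /idem -phiM h]. Qed.

Lemma germ_dom_pull s xi : germ_dom (s, pull_idem xi) <-> germ_dom (phi s, xi).
Proof.
rewrite /germ_dom /= /pull_idem phiM phi_star; split=> -[h1 h2]; split=> //.
  by have /tight_pull[eta ? /pull_idem_inj ->] := h1.
by apply/tight_pull; exists xi.
Qed.

(** An equality between images under [phi] lifts only after multiplication by some [b] with
    [phi b = sm_one]. Multiplying by such a [b] does not leave a pulled-back filter, so germs do not
    notice it. *)
Lemma germ_rel_pull s t xi : germ_rel (pull_idem xi) s t <->
  germ_rel xi (phi s) (phi t).
Proof.
split=> -[e [ie xe st]].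
  by exists (phi e); split; [exact/idem_phiE| |rewrite -!phiM st].
have iE : idem (psi e) by apply: idem_phi; rewrite psiK.
have /ker_phi[b [ib b1 st']] : phi (s ** psi e) = phi (t ** psi e).
  by rewrite !phiM psiK.
exists (psi e ** b); split; first exact: idem_mul.
  by rewrite /pull_idem phiM psiK b1 (im_mul1r invT).
by rewrite !(im_mulA invS).
Qed.

Lemma tight_act_pull s xi : germ_dom (phi s, xi) ->
  tight_act s (pull_idem xi) = pull_idem (tight_act (phi s) xi).
Proof.
move=> [/= /tight_is_filter[id_xi _ _ _ mul_xi] dom].
apply/funext => f; apply/asboolP/asboolP => -[if_ [e [xe le_f]]].
  split; first exact/idem_phiE.
  by exists (phi e); rewrite /idem_le -phi_star -!phiM le_f.
have {}if_ : idem f by exact/idem_phiE.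
split=> //; pose e0 := psi e.
have ie0 : idem e0 by apply/idem_phi; rewrite psiK; exact: id_xi.
have /ker_phi[b [ib b1 E]] : phi (s ** e0 ** s^*s ** f) = phi (s ** e0 ** s^*s).
  by rewrite !phiM phi_star psiK.
have C := im_idemC invS.
have ic : idem (s ** e0 ** s^*s) by exact: idem_conj.
have ir : idem (s^*s ** b ** s).
  by have := idem_conj invS s^*s ib; rewrite (im_starK invS).
(* The lifted inequality holds only after multiplication by [b]. Shrinking [e0] by [s^*s ** b ** s]
   produces exactly this factor after conjugation by [s], while under [phi] it only multiplies by
   the source idempotent of [phi s], which is in [xi]. *)
exists (e0 ** (s^*s ** b ** s)); split.
  rewrite /pull_idem !phiM phi_star b1 psiK (im_mul1r invT).
  exact: mul_xi.
have -> : s ** (e0 ** (s^*s ** b ** s)) ** s^*s = s ** e0 ** s^*s ** b.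
  have := C _ _ (idem_starr invS s) ib; rewrite -!(im_mulA invS) => <-.
  congr (s ** (e0 ** _)); rewrite !(im_mulA invS); congr (_ ** _).
  by have := im_mulsK invS s^*s; rewrite (im_starK invS).
by rewrite /idem_le -(im_mulA invS) (C b f) // (im_mulA invS) E.
Qed.

Lemma tight_act_tightS s (xi : idem_set S) :
  germ_dom (s, xi) -> tight_spectrum S (tight_act s xi).
Proof.
move=> ds; have /tight_pull[eta _ E] := ds.1; rewrite /= in E; subst xi.
have dt := (germ_dom_pull _ _).1 ds.
rewrite tight_act_pull //; apply/tight_pull.
by exists (tight_act (phi s) eta) => //; exact: tight_act_tightT.
Qed.

Lemma is_germ_pull_repr c : exists s xi, is_germ c s (pull_idem xi).
Proof.
have := is_germ_repr c; set s := (X in is_germ c X _); set eta := (X in is_germ c _ X).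
move=> h; have [[/= /tight_pull[xi _ E] _] _] := h.
by exists s, xi; rewrite -E.
Qed.

(** Both directions are chosen germ by germ and then described on all representatives ([Phi_germ],
    [Psi_germ]). Each compatibility with products and inverses is then a comparison of two germs
    with a common representative. *)
Theorem groupoid_iso_of_pull :
  exists Phi : G_tight S -> G_tight T,
    (forall s xi c, is_germ c s (pull_idem xi) -> is_germ (Phi c) (phi s) xi) /\
    top_groupoid_iso Phi.
Proof.
have F1 c : exists d, exists s xi, is_germ c s (pull_idem xi) /\ is_germ d (phi s) xi.
  have [s [xi cs]] := is_germ_pull_repr c.
  have [d ds] := is_germ_ex ((germ_dom_pull _ _).1 cs.1).
  by exists d, s, xi.
have F2 (d : tight_arrow T) : exists c, exists (t : T) xi,
    is_germ d t xi /\ is_germ c (psi t) (pull_idem xi).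
  have dt := is_germ_repr d; have := dt.1.
  set t := (germ_repr d).1 in dt *; set xi := (germ_repr d).2 in dt *.
  rewrite -[t]psiK => /germ_dom_pull /is_germ_ex[c ct].
  by exists c, t, xi.
have [Phi PhiP] := choice F1; have [Psi PsiP] := choice F2.
have Phi_germ s xi c : is_germ c s (pull_idem xi) -> is_germ (Phi c) (phi s) xi.
  move=> cs; have [t [eta [ct dt]]] := PhiP c.
  have [/pull_idem_inj E R] := is_germ_rel ct cs; subst eta.
  apply: (is_germ_congr invT dt); first exact/germ_dom_pull/cs.1.
  exact/germ_rel_pull.
have Psi_germ s xi d : is_germ d (phi s) xi -> is_germ (Psi d) s (pull_idem xi).
  move=> dt; have [t [eta [dt' ct]]] := PsiP d.
  have [E R] := is_germ_rel dt' dt; subst eta.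
  apply: (is_germ_congr invS ct); first exact/germ_dom_pull/dt.1.
  by apply/germ_rel_pull; rewrite psiK.
have PhiK : cancel Phi Psi.
  move=> c; have [s [xi [cs ds]]] := PhiP c.
  exact: is_germ_inj (Psi_germ _ _ _ ds) cs.
have PsiK : cancel Psi Phi.
  move=> d; have [t [xi [dt cs]]] := PsiP d.
  by have := Phi_germ _ _ _ cs; rewrite psiK => h; exact: is_germ_inj h dt.
have cPhi : continuous Phi.
  apply: continuous_germ => t U oU.
  (* Precomposition with the section [psi] undoes [pull_idem], so the open set [W] of the ambient
     space restricts to [U] on the pulled-back filters. *)
  pose W : set (idem_set S) := [set xi : idem_set S | U (fun u : T => xi (psi u))].
  have WE xi : W (pull_idem xi) = U xi.
    rewrite /W /=; congr U; apply/funext => u.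
    by rewrite /pull_idem psiK.
  have -> : Phi @^-1` germ_basic t U =
      germ_basic (psi t) W.
    apply/seteqP; split=> c /=.
      move=> [xi Uxi]; rewrite -{1}[t]psiK => /Psi_germ; rewrite PhiK => h.
      by exists (pull_idem xi) => //; rewrite WE.
    move=> [xi' Uxi] h; have [/= /tight_pull[xi _ E] _] := h.1; subst xi'.
    exists xi; first by rewrite -WE.
    by rewrite -[t]psiK; exact: Phi_germ.
  exists [set germ_basic (psi t) W]; last by rewrite bigcup_set1.
  move=> _ ->; apply: finI_from1.
  exists (psi t), W; split=> //.
  by move/continuousP: (@continuous_precomp S T bool psi); apply.
have cPsi : continuous Psi.
  apply: continuous_germ => s U oU.
  have -> : Psi @^-1` germ_basic s U = germ_basic (phi s) [set xi | U (pull_idem xi)].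
    apply/seteqP; split=> d /=.
      move=> [xi' Uxi] h; have [/= /tight_pull[xi _ E] _] := h.1; subst xi'.
      by exists xi => //; rewrite -[d]PsiK; exact: Phi_germ.
    by move=> [xi Uxi] /Psi_germ; exists (pull_idem xi).
  exists [set germ_basic (phi s) [set xi | U (pull_idem xi)]]; last by rewrite bigcup_set1.
  move=> _ ->; apply: finI_from1.
  exists (phi s), [set xi | U (pull_idem xi)]; split=> //.
  by move/continuousP: (@continuous_precomp T S bool phi); apply.
have srcP c : germ_src c = pull_idem (germ_src (Phi c)).
  have [s [xi [cs ds]]] := PhiP c.
  by rewrite (germ_srcE cs) (germ_srcE ds).
have rngP c : germ_rng c = pull_idem (germ_rng (Phi c)).
  have [s [xi [cs ds]]] := PhiP c.
  by rewrite (germ_rngE invS cs) (germ_rngE invT ds) tight_act_pull //; exact: ds.1.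
exists Phi; split=> //; split.
- by exists Psi.
- split=> // U oU; have -> : Phi @` U = Psi @^-1` U.
    apply/seteqP; split=> d /=; first by move=> [c Uc <-]; rewrite PhiK.
    by move=> Ud; exists (Psi d).
  exact: (continuousP _).1.
- move=> b c /=; rewrite srcP rngP; split=> [/pull_idem_inj //|-> //].
- move=> b c /=; rewrite srcP rngP => /pull_idem_inj E.
  have [s [xi [cs ds]]] := PhiP c; have [t [eta [bt et]]] := PhiP b.
  move: E; rewrite (germ_srcE et) (germ_rngE invT ds) => E; subst eta.
  have M := is_germ_mul invT ds et; rewrite -phiM in M.
  apply: is_germ_inj M; apply: Phi_germ; apply: (is_germ_mul invS cs).
  by rewrite tight_act_pull //; exact: ds.1.
- move=> c /=; have [s [xi [cs ds]]] := PhiP c.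
  have M := is_germ_inv invT tight_act_tightT ds; rewrite -phi_star in M.
  apply: is_germ_inj M; apply: Phi_germ.
  rewrite -tight_act_pull; last exact: ds.1.
  exact: (is_germ_inv invS tight_act_tightS cs).
Qed.

End GroupoidIso.

(** * Tight filters of a tree of idempotents *)

Section Words.
Variable X : finType.
Implicit Types (x : inf_word X) (al be : seq X).

Lemma size_word_prefix x m : size (word_prefix x m) = m.
Proof. exact: size_mkseq. Qed.

Lemma nth_word_prefix (x0 : X) x m k : k < m -> nth x0 (word_prefix x m) k = x k.
Proof. exact: nth_mkseq. Qed.

Lemma take_word_prefix x m n : n <= m -> take n (word_prefix x m) = word_prefix x n.
Proof. by move=> nm; rewrite /word_prefix /mkseq -map_take take_iota (minn_idPl nm). Qed.

Lemma prefix_word_prefix x al m : prefix al (word_prefix x m) ->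
  al = word_prefix x (size al).
Proof.
move=> p; move: (p); rewrite prefixE => /eqP <-.
by rewrite take_word_prefix ?size_word_prefix // -(size_word_prefix x m) size_prefix.
Qed.

Lemma word_prefix_prefix x m n : m <= n -> prefix (word_prefix x m) (word_prefix x n).
Proof. by move=> mn; rewrite prefixE size_word_prefix take_word_prefix. Qed.

Lemma prefix_size_eq al be : prefix al be -> size be <= size al -> al = be.
Proof.
by move=> p s; move: p; rewrite prefixE take_oversize // => /eqP.
Qed.

Lemma nth_prefix (x0 : X) al be k :
  prefix al be -> k < size al -> nth x0 be k = nth x0 al k.
Proof. by move=> /prefixP[s ->] h; rewrite nth_cat h. Qed.

Lemma word_prefix_inj x y : (forall m, word_prefix x m = word_prefix y m) -> x = y.
Proof.
move=> h; apply/funext => k.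
by rewrite -(nth_word_prefix (x k) x (ltnSn k)) h nth_word_prefix.
Qed.

End Words.

Section TreeSpectrum.
Variables (S : star_monoid0) (X : finType) (letter : X) (e : seq X -> nat -> S).

(* The second argument of [e] carries no information about the spectrum: it
   only makes room for the elements B_n of the semilattice of S_P. *)
Record tree_idempotents : Prop := TreeIdempotents {
  ti_idemP : forall s, idem s <-> s = sm_zero \/ exists al n, s = e al n;
  ti_neq0 : forall al n, e al n <> sm_zero;
  ti_inj : forall al be m n, e al m = e be n -> al = be;
  ti_mul : forall al be m n, prefix be al -> exists k, e al m ** e be n = e al k;
  ti_mulC : forall al be m n, e al m ** e be n = e be n ** e al m;
  ti_mul_eq0 : forall al be m n, ~~ prefix al be -> ~~ prefix be al ->
    e al m ** e be n = sm_zero;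
  ti_mul0s : forall s : S, sm_zero ** s = sm_zero;
  ti_muls0 : forall s : S, s ** sm_zero = sm_zero
}.

Hypothesis eP : tree_idempotents.
Implicit Types (x y : inf_word X) (xi ze : idem_set S) (al be : seq X).

Definition tree_point (x : inf_word X) : idem_set S :=
  fun s => `[< exists m n, s = e (word_prefix x m) n >].

Lemma tree_pointE x al n : tree_point x (e al n) = (al == word_prefix x (size al)).
Proof.
apply/asboolP/eqP => [[m [k /(ti_inj eP) ->]]|->]; first by rewrite size_word_prefix.
by exists (size al), n.
Qed.

Lemma filter_neq0 xi : is_filter xi -> ~ xi sm_zero.
Proof.
move=> [_ _ [f if_ /negP nf] up_xi _] x; apply: nf.
by apply: (up_xi sm_zero) => //; rewrite /idem_le (ti_mul0s eP).
Qed.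

Lemma filter_comparable xi al be m n : is_filter xi ->
  xi (e al m) -> xi (e be n) -> prefix al be || prefix be al.
Proof.
move=> F xa xb; apply/negPn/negP; rewrite negb_or => /andP[h1 h2].
apply: (filter_neq0 F); rewrite -(ti_mul_eq0 eP m n h1 h2).
by case: F => _ _ _ _; apply.
Qed.

Lemma tree_point_filter x : is_filter (tree_point x).
Proof.
have i al n : idem (e al n) by apply/(ti_idemP eP); right; exists al, n.
split.
- by move=> f /asboolP[m [n ->]].
- by exists (e (word_prefix x 0) 0); apply/asboolP; exists 0, 0.
- exists sm_zero; first by rewrite /idem (ti_mul0s eP).
  by apply/asboolP => -[m [n /esym /(ti_neq0 eP)]].
- move=> f g /asboolP[m [n ->]] /(ti_idemP eP)[->|[al [k ->]]]; rewrite /idem_le.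
    by rewrite (ti_muls0 eP) => /esym /(ti_neq0 eP).
  rewrite tree_pointE.
  have [p _|np] := boolP (prefix al (word_prefix x m)).
    exact/eqP/(prefix_word_prefix p).
  have [p|np'] := boolP (prefix (word_prefix x m) al).
    have [l El] := ti_mul eP k n p.
    rewrite (ti_mulC eP) El => /(ti_inj eP) ->.
    by rewrite size_word_prefix.
  by rewrite (ti_mul_eq0 eP) // => /esym /(ti_neq0 eP).
- move=> f g /asboolP[m [n ->]] /asboolP[m' [n' ->]].
  have [le|/ltnW le] := leqP m m'.
    have [k E] := ti_mul eP n' n (word_prefix_prefix x le).
    by rewrite (ti_mulC eP) E tree_pointE size_word_prefix.
  have [k ->] := ti_mul eP n n' (word_prefix_prefix x le).
  by rewrite tree_pointE size_word_prefix.
Qed.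

(** Words in a filter are pairwise comparable, hence agree on each letter that they share; these
    letters spell [x]. Positions that no word of the filter reaches receive the default [letter]. *)
Lemma filter_sub_tree_point xi : is_filter xi ->
  exists x, forall s, xi s -> tree_point x s.
Proof.
move=> F.
have /choice[x xP] k : exists z, forall al n, xi (e al n) -> k < size al -> nth letter al k = z.
  have [[al [n [xa ka]]]|no] :=
      pselect (exists al n, xi (e al n) /\ k < size al); last first.
    by exists letter => al n xa ka; case: no; exists al, n.
  exists (nth letter al k) => be m xb kb.
  by have /orP[p|p] := filter_comparable F xa xb; [|apply: esym]; exact: nth_prefix.
exists x => s xs; case: (F) => id_xi _ _ _ _.
case/(ti_idemP eP): (id_xi _ xs) => [s0|[al [n E]]].
  by case: (filter_neq0 F); rewrite -s0.
rewrite E tree_pointE; apply/eqP/(@eq_from_nth _ letter); first by rewrite size_word_prefix.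
by move=> k ka; rewrite nth_word_prefix //; apply: (xP k _ n) => //; rewrite -E.
Qed.

Lemma tree_point_maximal x ze : is_filter ze ->
  (forall s, tree_point x s -> ze s) -> ze = tree_point x.
Proof.
move=> F h; have [y yP] := filter_sub_tree_point F.
have E : x = y.
  apply: word_prefix_inj => m.
  have : tree_point y (e (word_prefix x m) 0).
    by apply/yP/h; rewrite tree_pointE size_word_prefix.
  by rewrite tree_pointE size_word_prefix => /eqP.
by apply/funext => s; apply/idP/idP; [rewrite E; exact: yP|exact: h].
Qed.

Lemma ultrafilterP xi : is_ultrafilter xi <-> exists x, xi = tree_point x.
Proof.
split=> [[F max_xi]|[x ->]].
  have [x h] := filter_sub_tree_point F; exists x; apply: esym.
  exact: max_xi (tree_point_filter x) h.
by split=> [|ze F]; [exact: tree_point_filter|exact: tree_point_maximal].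
Qed.

Lemma near_idem_set (I : finType) (s : I -> S) (xi : idem_set S) :
  \forall eta \near xi, forall i, eta (s i) = xi (s i).
Proof.
apply: (@filter_forall _ I (fun i eta => eta (s i) = xi (s i)) (nbhs xi) _) => i.
exact: near_ptws_eq.
Qed.

(** There are finitely many words of length m, so a limit [xi] of ultrafilters agrees on all of them
    with some ultrafilter, and thus contains one of them. Being inside a point [x], it contains the
    prefix of [x] of that length. *)
Lemma tight_tree_point xi : tight_spectrum S xi <-> exists x, xi = tree_point x.
Proof.
split=> [[/= F cl]|[x ->]]; last first.
  split; first exact: tree_point_filter.
  by apply: subset_closure; apply/ultrafilterP; exists x.
have [x h] := filter_sub_tree_point F; exists x.
apply: tree_point_maximal F _ => s /asboolP[m [n ->]].
have [eta [/ultrafilterP[y ->] E]] := cl _ (near_idem_set (fun t : m.-tuple X => e t n) xi).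
have sz : size (word_prefix y m) == m by rewrite size_word_prefix.
have xy : xi (e (word_prefix y m) n).
  by rewrite -(E (Tuple sz)) tree_pointE size_word_prefix.
by have := h _ xy; rewrite tree_pointE size_word_prefix => /eqP <-.
Qed.

(** Membership of [e al n] depends on the first |al| letters only; elements outside the family
    belong to no point. *)
Lemma tree_point_continuous : continuous tree_point.
Proof.
apply: continuous_ptws => x s.
have [[al [n ->]]|no] := pselect (exists al n, s = e al n); last first.
  apply: (@filterE _ (nbhs x) _) => y.
  by rewrite /tree_point !asboolF // => -[m [n E]]; apply: no;
    [exists (word_prefix x m), n|exists (word_prefix y m), n].
have W : \forall y \near x, forall i : 'I_(size al), (y : inf_word X) i = x i.
  apply: (@filter_forall _ 'I_(size al) (fun i (y : inf_word X) => y i = x i) (nbhs x) _) => i.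
  exact: (near_ptws_eq (D := discrete_topology X)).
apply: (@filterS _ (nbhs x) _ _ _ _ W) => y yx; rewrite !tree_pointE; congr (_ == _).
apply: (@eq_from_nth _ letter); rewrite ?size_word_prefix // => k ka.
by rewrite !nth_word_prefix //; exact: (yx (Ordinal ka)).
Qed.

(** A continuous left inverse of [tree_point]: letter k is found by a search among the finitely many
    words of length k+1, so it is locally constant. *)
Definition tree_coord (xi : idem_set S) : inf_word X := fun k =>
  if [pick t : k.+1.-tuple X | xi (e t 0)] is Some t then last letter t else letter.

Lemma tree_coord_continuous : continuous tree_coord.
Proof.
apply: (@continuous_ptws _ _ (discrete_topology X)) => xi k.
apply: filterS (near_idem_set (fun t : k.+1.-tuple X => e t 0) xi) => eta E.
by rewrite /tree_coord (eq_pick E).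
Qed.

Lemma tree_pointK : cancel tree_point tree_coord.
Proof.
move=> x; apply/funext => k; rewrite /tree_coord; case: pickP => [t|no].
  rewrite tree_pointE size_tuple -nth_last size_tuple => /eqP ->.
  exact: nth_word_prefix.
have sz : size (word_prefix x k.+1) == k.+1 by rewrite size_word_prefix.
by have := no (Tuple sz); rewrite tree_pointE size_word_prefix eqxx.
Qed.

Lemma tree_point_homeo : homeo_onto tree_point (tight_spectrum S).
Proof.
split; [split| exact: tree_point_continuous|].
- by move=> x _; apply/tight_tree_point; exists x.
- by move=> x y _ _ /(congr1 tree_coord); rewrite !tree_pointK.
- by move=> xi /tight_tree_point[x ->]; exists x.
move=> V oV; exists (tree_coord @^-1` V).
  by move/continuousP: tree_coord_continuous; apply.
apply/seteqP; split=> [_ [x Vx <-]|xi [/= Vx /tight_tree_point[x E]]].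
  by split; [rewrite /= tree_pointK|apply/tight_tree_point; exists x].
by exists x => //; move: Vx; rewrite E tree_pointK.
Qed.

End TreeSpectrum.

(** * The inverse semigroup of a self-similar action *)

Lemma prefix_cases (X : eqType) (al be : seq X) :
  [\/ exists w, be = al ++ w, exists w, al = be ++ w |
      ~~ prefix al be /\ ~~ prefix be al].
Proof.
have [/prefixP|n1] := boolP (prefix al be); first by constructor 1.
have [/prefixP|n2] := boolP (prefix be al); first by constructor 2.
by constructor 3.
Qed.

Lemma prefix_cat_comparable (X : eqType) (al be v w : seq X) :
  al ++ v = be ++ w -> prefix al be || prefix be al.
Proof.
by elim: al be => [|x al IH] [|y be] //= [-> /IH]; rewrite eqxx.
Qed.

Section SelfSimilarInverseMonoid.
Variables (G : groupType) (X : finType) (a : self_similar_action G X).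
Implicit Types (al be ga de w v : seq X) (g h k : G).

Lemma actKV g v : act a g (act a g^-1%g v) = v.
Proof. by rewrite -actM mulgV act1. Qed.

Lemma actK g v : act a g^-1%g (act a g v) = v.
Proof. by rewrite -actM mulVg act1. Qed.

Lemma restrV g v : restr a g^-1%g v = (restr a g (act a g^-1 v))^-1%g.
Proof. by apply: (mulgI (restr a g (act a g^-1%g v))); rewrite mulgV -restrM mulgV restr1. Qed.

Lemma sgx_mul_catr al g ga w k si :
  sgx a al g ga ** sgx a (ga ++ w) k si =
  sgx a (al ++ act a g w) (restr a g w * k)%g si.
Proof. by rewrite /sgx /= prefix_prefix drop_size_cat. Qed.

Lemma sgx_mul_catl al g de w k si :
  sgx a al g (de ++ w) ** sgx a de k si =
  sgx a al (g * (restr a k^-1 w)^-1)%g (si ++ act a k^-1%g w).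
Proof.
(* [sgx_mul] tests the opposite prefix relation first. Both tests succeed only for empty [w], where
   the two formulas agree. *)
rewrite /sgx /=; case: ifP => [p|_]; last by rewrite prefix_prefix drop_size_cat.
have w0 : w = [::].
  by apply/nilP; move/size_prefix: p; rewrite /nilp size_cat; case: (size w) => // n; lia.
by rewrite w0 cats0 drop_size !(act_nil, restr_nil) !cats0 invgK.
Qed.

Lemma sgx_mul_eq0 al g ga de k si : ~~ prefix ga de -> ~~ prefix de ga ->
  sgx a al g ga ** sgx a de k si = sm_zero.
Proof. by move=> /negbTE h1 /negbTE h2; rewrite /sgx /= h1 h2. Qed.

(** The graph of ga v |-> al (g . v) on finite words. Unlike on infinite words, the shortest element
    of the domain is visible here and recovers [ga]. *)
Definition sgx_rel (s : S_GX a) (w w' : seq X) : Prop :=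
  if s is Some (al, g, ga) then exists2 v, w = ga ++ v & w' = al ++ act a g v
  else False.

Lemma sgx_rel_base al g ga v : sgx_rel (sgx a al g ga) (ga ++ v) (al ++ act a g v).
Proof. by exists v. Qed.

(** Each base word lies in the domain of the other element, so comparing lengths identifies [ga] and
    [al]; faithfulness of the action on X^* identifies [g]. *)
Lemma sgx_rel_inj (s t : S_GX a) :
  (forall w w', sgx_rel s w w' <-> sgx_rel t w w') -> s = t.
Proof.
case: s t => [[[al g] ga]|] [[[be h] de]|] // E; last first.
- by have /E := sgx_rel_base be h de [::].
- by have /E := sgx_rel_base al g ga [::].
have /E[v] := sgx_rel_base al g ga [::]; rewrite act_nil !cats0 => e1 e2.
have /E[v'] := sgx_rel_base be h de [::]; rewrite act_nil !cats0 => e3 e4.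
have v0 : v = [::].
  by apply/nilP; move: (congr1 size e1) (congr1 size e3); rewrite !size_cat /nilp; lia.
subst v; rewrite !(act_nil, cats0) in e1 e2; subst al ga; congr (Some (_, _, _)).
apply: (act_inj (a := a)) => v; have /E[v2 /cat_injr <-] := sgx_rel_base be g de v.
exact: cat_injr.
Qed.

Lemma sgx_rel_repr : partial_bij_repr sgx_rel.
Proof.
split.
- exact: sgx_rel_inj.
- move=> [[[al g] ga]|] [[[de k] si]|] x y; try by split=> // -[z]; case.
  have [[w ->]|[w ->]|[n1 n2]] := prefix_cases ga de.
  + rewrite [_ ** _]sgx_mul_catr; split.
      move=> [v -> ->]; exists (ga ++ w ++ act a k v); first by exists v; rewrite ?catA.
      by exists (w ++ act a k v); rewrite // act_cat actM catA.
    move=> [z [v -> ->]]; rewrite -catA => -[v' /cat_injr <- ->].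
    by exists v; rewrite // act_cat actM catA.
  + rewrite [_ ** _]sgx_mul_catl; split.
      move=> [v -> ->]; exists (de ++ w ++ act a (restr a k^-1 w)^-1%g v).
        exists (act a k^-1%g w ++ v); first by rewrite catA.
        by rewrite act_cat actKV restrV invgK.
      by exists (act a (restr a k^-1 w)^-1%g v); rewrite ?catA // actM.
    move=> [z [v -> ->]] [v']; rewrite -catA => /cat_injr E ->.
    exists (act a (restr a k^-1 w) v'); last by rewrite -actM mulgVK.
    by rewrite -catA -act_cat -E actK.
  + rewrite [_ ** _]sgx_mul_eq0 //; split=> // -[z [v -> ->] [v' /prefix_cat_comparable]].
    by rewrite (negbTE n1) (negbTE n2).
- move=> [[[al g] ga]|] x y //=; split=> -[v -> ->].
    by exists (act a g^-1%g v); rewrite // actKV.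
  by exists (act a g v); rewrite // actK.
- move=> x y; split=> [[v -> ->]|<-]; first by rewrite act1.
  by exists x; rewrite // act1.
- move=> [[[al g] ga]|] x y z //= [v -> ->] [v' /cat_injr -> ->] //.
Qed.

Lemma sgx_inverse_monoid : inverse_monoid (S_GX a).
Proof. exact: pb_inverse_monoid sgx_rel_repr. Qed.

(** The dummy index [n] gives this family the two arguments expected by [tree_idempotents]. *)
Definition sgx_idem al (n : nat) : S_GX a := sgx a al 1%g al.

Lemma sgx_tree_idempotents : tree_idempotents sgx_idem.
Proof.
have catl al w m n : sgx_idem (al ++ w) m ** sgx_idem al n = sgx_idem (al ++ w) m.
  by rewrite /sgx_idem sgx_mul_catl invg1 act1 restr1 invg1 mulg1.
have catr al w m n : sgx_idem al m ** sgx_idem (al ++ w) n = sgx_idem (al ++ w) m.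
  by rewrite /sgx_idem sgx_mul_catr act1 restr1 mulg1.
split.
- move=> s; split=> [|[->|[al [n ->]]]] //; last first.
    by have := catl al [::] n n; rewrite cats0.
  move/(pb_idemP sgx_rel_repr); case: s => [[[al g] ga]|]; last by left.
  move=> h; right; exists al, 0.
  have /h := sgx_rel_base al g ga [::]; rewrite act_nil !cats0 => E; subst ga.
  congr (Some (_, _, _)); apply: (act_faithful (s := a)) => v.
  by have /h/cat_injr <- := sgx_rel_base al g al v.
- by [].
- by move=> al be m n [].
- by move=> al be m n /prefixP[w ->]; exists m; rewrite catl.
- move=> al be m n; have [[w ->]|[w ->]|[n1 n2]] := prefix_cases al be.
  + by rewrite catl catr.
  + by rewrite catl catr.
  + by rewrite /sgx_idem !sgx_mul_eq0.
- by move=> al be m n; exact: sgx_mul_eq0.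
- by move=> s; exact: erefl.
- by case=> [[[al g] ga]|]; exact: erefl.
Qed.

Lemma sgx_pointE x : sgx_point a x = tree_point sgx_idem x.
Proof.
apply/funext => s; apply/asboolP/asboolP; first by move=> [m ->]; exists m, 0.
by move=> [m [n ->]]; exists m.
Qed.

Definition shift_word (x : inf_word X) n : inf_word X := fun i => x (n + i).

Lemma word_prefix_shift x n m :
  word_prefix x (n + m) = word_prefix x n ++ word_prefix (shift_word x n) m.
Proof. by rewrite /word_prefix /mkseq iotaD map_cat add0n -{2}[n]addn0 iotaDl -map_comp. Qed.

(* The infinite word al (g . z). *)
Definition act_word (letter : X) al g (z : inf_word X) : inf_word X :=
  fun i => nth letter (al ++ act a g (word_prefix z i.+1)) i.

(** Since g preserves prefixes, the words al (g . z_1...z_i) form a chain, and a letter may be read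
    off any member that is long enough. *)
Lemma word_prefix_act letter al g z m :
  word_prefix (act_word letter al g z) (size al + m) = al ++ act a g (word_prefix z m).
Proof.
have sz : size (al ++ act a g (word_prefix z m)) = size al + m.
  by rewrite size_cat act_size size_word_prefix.
apply: (@eq_from_nth _ letter); rewrite size_word_prefix // => k km.
rewrite nth_word_prefix // /act_word.
have P i j : i <= j -> prefix (al ++ act a g (word_prefix z i)) (al ++ act a g (word_prefix z j)).
  by move=> /(word_prefix_prefix z)/prefixP[w ->]; rewrite act_cat catA prefix_prefix.
have [le|/ltnW le] := leqP k.+1 m.
  apply/esym/(nth_prefix letter (P _ _ le)).
  by rewrite size_cat act_size size_word_prefix addnS ltnS leq_addl.
by apply: (nth_prefix letter (P _ _ le)); rewrite sz.
Qed.

Lemma sgx_conj_idem al g ga w n :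
  sgx a al g ga ** sgx_idem (ga ++ w) n ** (sgx a al g ga)^*s =
  sgx_idem (al ++ act a g w) n.
Proof.
rewrite /sgx_idem sgx_mul_catr mulg1.
have -> : (sgx a al g ga)^*s = sgx a ga g^-1%g al by [].
by rewrite sgx_mul_catl invgK mulgV.
Qed.

Lemma sgx_tight_act_tight (letter : X) (s : S_GX a) xi :
  germ_dom (s, xi) -> tight_spectrum _ (tight_act s xi).
Proof.
have TI := sgx_tree_idempotents.
move=> [/= /(tight_tree_point letter TI)[x ->]].
case: s => [[[al g] ga]|]; last by move=> /(filter_neq0 TI (tree_point_filter TI x)).
rewrite -/(sgx a al g ga) => dom.
have gaE : ga = word_prefix x (size ga).
  have E : (sgx a al g ga)^*s ** sgx a al g ga = sgx_idem ga 0.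
    have := sgx_mul_catr ga g^-1%g al [::] g ga.
    by rewrite act_nil restr_nil !cats0 mulVg.
  have : tree_point sgx_idem x (sgx_idem ga 0) by rewrite -E.
  by rewrite (tree_pointE TI) => /eqP.
pose z := shift_word x (size ga); pose y := act_word letter al g z.
apply/(tight_tree_point letter TI); exists y.
have xE m : word_prefix x (size ga + m) = ga ++ word_prefix z m.
  by rewrite word_prefix_shift -gaE.
have conjE m n : sgx a al g ga ** sgx_idem (word_prefix x (size ga + m)) n **
    (sgx a al g ga)^*s = sgx_idem (word_prefix y (size al + m)) n.
  by rewrite xE sgx_conj_idem word_prefix_act.
have [_ _ _ up_y _] := tree_point_filter TI y.
apply/funext => f; apply/idP/idP.
  move=> /asboolP[if_ [e [/asboolP[m [n ->]] le_f]]].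
  apply: up_y if_ le_f.
  have [le|/ltnW le] := leqP (size ga) m.
    by rewrite -(subnKC le) conjE (tree_pointE TI) size_word_prefix.
  (* A prefix of [x] shorter than [ga] gives an idempotent above the source, so its conjugate is the
     whole range idempotent. *)
  have -> : sgx a al g ga ** sgx_idem (word_prefix x m) n = sgx a al g ga.
    have := word_prefix_prefix x le; rewrite -gaE => /prefixP[w ->].
    by rewrite sgx_mul_catl invg1 act1 restr1 invg1 mulg1.
  have -> : sgx a al g ga ** (sgx a al g ga)^*s = sgx_idem al 0.
    have := sgx_mul_catr al g ga [::] g^-1%g al.
    by rewrite act_nil restr_nil !cats0 mulgV.
  rewrite (tree_pointE TI); apply/eqP.
  by have := word_prefix_act letter al g z 0; rewrite act_nil addn0 cats0.
move=> /asboolP[m [n ->]]; apply/asboolP; split.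
  by apply/(ti_idemP TI); right; exists (word_prefix y m), n.
(* This prefix of [x] is carried to the prefix of [y] of length |al| + m, which extends the one of
   length m. *)
exists (sgx_idem (word_prefix x (size ga + m)) n); split.
  by rewrite (tree_pointE TI) size_word_prefix.
rewrite conjE /idem_le.
have /prefixP[w ->] := word_prefix_prefix y (leq_addl (size al) m).
by rewrite /sgx_idem sgx_mul_catl invg1 act1 restr1 invg1 mulg1.
Qed.

End SelfSimilarInverseMonoid.

(** * The inverse semigroup S_P *)

Section ZappaSzepIdeals.
Variables (G : groupType) (X : finType) (a : self_similar_action G X).
Hypothesis rec_a : recurrent a.
Local Notation P := (zappa_szep a).
Implicit Types (al be ga de si w : seq X) (g h k : G) (p q r u : P).

Lemma zs_mulE p q :
  (p * q)%g = zs a (p.1 ++ act a p.2 q.1) (restr a p.2 q.1 * q.2)%g.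
Proof. by []. Qed.

Lemma zsM al g be h :
  (zs a al g * zs a be h)%g = zs a (al ++ act a g be) (restr a g be * h)%g.
Proof. by []. Qed.

Lemma size_zsM p q : size (p * q)%g.1 = size p.1 + size q.1.
Proof. by case: p q => [al g] [be h]; rewrite zsM /= size_cat act_size. Qed.

(** Recurrence gives [m] sending [al] to the tail of [de] of the same length, with exactly the
    restriction that corrects the group component. *)
Lemma left_idealP p q : left_ideal p q <-> size p.1 <= size q.1.
Proof.
split=> [[x _ <-]|]; first by rewrite size_zsM leq_addl.
case: p q => [al g] [de k] /= le.
have sz : size al = size (drop (size de - size al) de) by rewrite size_drop subKn.
have [m [mal res]] := rec_a (k * g^-1)%g sz.
exists (zs a (take (size de - size al) de) m) => //.
by rewrite [LHS]zsM mal res mulgVK cat_take_drop.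
Qed.

Lemma right_idealP p q : right_ideal p q <-> prefix p.1 q.1.
Proof.
split=> [[x _ <-]|].
  by case: p x => [al g] [be h]; rewrite zsM /= prefix_prefix.
case: p q => [al g] [de k] /= /prefixP[w ->].
exists (zs a (act a g^-1%g w) ((restr a g (act a g^-1 w))^-1 * k)%g) => //.
by rewrite [LHS]zsM actKV mulVKg.
Qed.

Lemma zs_mulI p : injective (fun q : P => (p * q)%g).
Proof.
case: p => al g [be h] [de k]; rewrite !zsM => -[/cat_injr E].
have {E} -> : be = de by rewrite -[be](actK a g) E actK.
by move=> /mulgI ->.
Qed.

Lemma zs_unit g : is_unit (zs a [::] g).
Proof.
exists (zs a [::] g^-1%g); rewrite !zsM !(act_nil, restr_nil).
by rewrite mulgV mulVg.
Qed.

Lemma zs_unit_nil u : is_unit u -> u.1 = [::].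
Proof.
move=> [v [/(congr1 (fun p : P => size p.1)) + _]]; rewrite size_zsM /=.
by case: (u.1).
Qed.

Lemma left_ideal_self p : left_ideal p p.
Proof. by exists 1%g; rewrite ?mul1g. Qed.

Lemma right_ideal_self p : right_ideal p p.
Proof. by exists 1%g; rewrite ?mulg1. Qed.

Lemma left_ideal_cap p q : exists x y l,
  left_ideal p `&` left_ideal q = left_ideal l /\ (x * p = l /\ y * q = l)%g.
Proof.
have capE (l : P) : size l.1 = maxn (size p.1) (size q.1) ->
    left_ideal p `&` left_ideal q = left_ideal l.
  move=> E; apply/seteqP; split=> z /=; rewrite !left_idealP E geq_max.
    by move=> [-> ->].
  by move=> /andP[].
have [le|/ltnW le] := leqP (size p.1) (size q.1).
  have [x _ E] := (left_idealP p q).2 le.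
  exists x, 1%g, q; rewrite mul1g; split=> //; apply: capE.
  by rewrite (maxn_idPr le).
have [x _ E] := (left_idealP q p).2 le.
exists 1%g, x, p; rewrite mul1g; split=> //; apply: capE.
by rewrite (maxn_idPl le).
Qed.

(** [sp_mul_graph] admits any generator [l]; all of them have this length, which is what fixes the
    degree of a product. *)
Lemma left_ideal_capE p q (l : P) :
  left_ideal p `&` left_ideal q = left_ideal l -> size l.1 = maxn (size p.1) (size q.1).
Proof.
move=> E; have [x [y [l' [E' _]]]] := left_ideal_cap p q.
have Il : (left_ideal p `&` left_ideal q) l by rewrite E; exact: left_ideal_self.
have [/left_idealP h1 /left_idealP h2] := Il.
apply/eqP; rewrite eqn_leq geq_max h1 h2 /= andbT leq_max.
have [le|/ltnW le] := leqP (size p.1) (size q.1).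
  apply/orP; right; apply/left_idealP; rewrite -E; split; last exact: left_ideal_self.
  exact/left_idealP.
apply/orP; left; apply/left_idealP; rewrite -E; split; first exact: left_ideal_self.
exact/left_idealP.
Qed.

Lemma right_ideal_capl p q : prefix q.1 p.1 ->
  right_ideal p `&` right_ideal q = right_ideal p.
Proof.
move=> qp; apply/seteqP; split=> z /=; first by case.
by rewrite !right_idealP => pz; split=> //; exact: prefix_trans pz.
Qed.

Lemma right_ideal_size p q : right_ideal p = right_ideal q -> size p.1 = size q.1.
Proof.
move=> E; apply/eqP; rewrite eqn_leq !size_prefix //; apply/right_idealP.
  by rewrite -E; exact: right_ideal_self.
by rewrite E; exact: right_ideal_self.
Qed.

Lemma right_ideal_cap_comparable p q (k : P) :
  right_ideal p `&` right_ideal q = right_ideal k -> prefix p.1 q.1 || prefix q.1 p.1.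
Proof.
move=> E; have [] : (right_ideal p `&` right_ideal q) k.
  by rewrite E; exact: right_ideal_self.
move=> /right_idealP/prefixP[w Ew] /right_idealP/prefixP[v Ev].
by apply: (@prefix_cat_comparable _ _ _ w v); rewrite -Ew -Ev.
Qed.

End ZappaSzepIdeals.

Section SpClass.
Variable P : monoidType.
Implicit Types p q r : P.

Lemma sp_classT p q r (ok : `[< sp_ok (p, q, r) >]) : sp_class p q r =
  Some (\pi_({eq_quot (sp_equiv P)})%qT (exist _ (p, q, r) ok : sp_triple P)).
Proof. by rewrite /sp_class insubT. Qed.

Lemma sp_class_eq p q r a b c : sp_ok (p, q, r) -> sp_ok (a, b, c) ->
  sp_class p q r = sp_class a b c <-> sp_rel (p, q, r) (a, b, c).
Proof.
move=> /asboolP ok1 /asboolP ok2; rewrite !sp_classT; split.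
  by move=> [/eqP]; rewrite eqmodE => /asboolP.
by move=> h; congr Some; apply/eqP; rewrite eqmodE; apply/asboolP.
Qed.

Lemma sp_sort_cases (s : S_P P) : s = sm_zero \/
  exists p q r, sp_ok (p, q, r) /\ s = sp_class p q r.
Proof.
case: s => [c|]; last by left.
right; case E : (repr c) => [[[p q] r] ok]; exists p, q, r; split.
  exact/asboolP.
by rewrite (sp_classT ok) -E reprK.
Qed.

End SpClass.

(** * Normal forms, products and degrees in S_P *)

Section SpNormal.
Variables (G : groupType) (X : finType) (a : self_similar_action G X).
Variable letter : X.
Hypothesis rec_a : recurrent a.
Local Notation P := (zappa_szep a).
Implicit Types (al be ga de si w : seq X) (g h k : G) (n m : nat).

(* [sp_norm al g ga n] is the element [(al, g)][(ga, 1)]^* B_n; these are all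
   the nonzero elements when n ranges over the integers with |al| <= n + |ga|. *)
Definition sp_norm al g ga n : S_P P :=
  sp_class (zs a al g) (zs a (nseq n letter ++ ga) 1%g) (zs a (nseq n letter) 1%g).

Lemma sp_okP (p q r : P) : sp_ok (p, q, r) <->
  size p.1 <= size q.1 /\ exists r1, q = (r * r1)%g.
Proof.
split=> [[[r1 _ E] /(left_idealP rec_a) le]|[le [r1 E]]].
  by split=> //; exists r1.
by split; [exists r1|apply/(left_idealP rec_a)].
Qed.

Lemma sp_norm_ok al g ga n : size al <= n + size ga ->
  sp_ok (zs a al g, zs a (nseq n letter ++ ga) 1%g, zs a (nseq n letter) 1%g).
Proof.
move=> le; apply/sp_okP; split; first by rewrite /= size_cat size_nseq.
by exists (zs a ga 1%g); rewrite zsM act1 restr1 mulg1.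
Qed.

(** The unit [(zs a [::] r1.2)] moves the group part of [r1] into [p], and recurrence supplies a
    unit turning the standard word of length |r| into [r]. Of [r] only the length survives. *)
Lemma sp_class_norm (p r r1 : P) : size p.1 <= size (r * r1)%g.1 ->
  sp_class p (r * r1)%g r = sp_norm p.1 (p.2 * r1.2^-1)%g r1.1 (size r.1).
Proof.
move=> le; apply/sp_class_eq.
- by apply/sp_okP; split=> //; exists r1.
- by apply: sp_norm_ok; rewrite -size_zsM.
have sz : size (nseq (size r.1) letter) = size r.1 by rewrite size_nseq.
have [v [v1 v2]] := rec_a r.2 sz.
exists (zs a [::] r1.2), (zs a [::] v); split; [exact: zs_unit|exact: zs_unit|].
case: p {le} r1 => [al g] [ga k]; case: r sz v1 v2 => [rho h] /= _ v1 v2.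
rewrite !zs_mulE /= !act_nil !restr_nil !cats0 v1 v2.
split; rewrite /zs; congr pair; rewrite ?mulg1 ?mulgVK //.
  by rewrite act_cat v1 v2.
by rewrite restr_cat v2.
Qed.

(** The third components say that [v] fixes the standard word with trivial restriction. The middle
    components then force [ga = de] and [u] trivial. *)
Lemma sp_norm_inj al g ga n be h de m :
  size al <= n + size ga -> size be <= m + size de ->
  sp_norm al g ga n = sp_norm be h de m -> [/\ al = be, g = h, ga = de & n = m].
Proof.
move=> ok1 ok2 /(sp_class_eq (sp_norm_ok g ok1) (sp_norm_ok h ok2)).
move=> [[u u2] [[v v2] [/zs_unit_nil /= u0 /zs_unit_nil /= v0]]].
rewrite {}u0 {}v0 -!/(zs a _ _) !zsM !act_nil !cats0 !restr_nil /=.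
case=> -[-> ->] [E1 E2] [E3 E4].
have nm : n = m by move: (congr1 size E3); rewrite act_size !size_nseq.
subst m; move: E1 E2; rewrite act_cat -E3 => /cat_injr -> E2.
have w1 : restr a v2 (nseq n letter) = 1%g by move: E4; rewrite mulg1.
rewrite w1 act1 in E2 *; split=> //.
move: E2; rewrite restr_cat w1 restr1 !mulg1 mul1g => <-.
by rewrite mulg1.
Qed.

Lemma sp_cases (s : S_P P) : s = sm_zero \/
  exists al g ga n, size al <= n + size ga /\ s = sp_norm al g ga n.
Proof.
case: (sp_sort_cases s) => [->|[p [q [r [/sp_okP[le [r1 E]] ->]]]]]; first by left.
right; exists p.1, (p.2 * r1.2^-1)%g, r1.1, (size r.1).
rewrite E in le *; split; first by rewrite -size_zsM.
exact: sp_class_norm.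
Qed.

Definition sp_of (s : S_GX a) n : S_P P :=
  if s is Some (al, g, ga) then sp_norm al g ga n else None.

(* [sgx a p.1 (p.2 * q.2^-1) q.1] plays the role of p q^{-1}: if b b1 = q q1 is
   a least common right multiple, p q^{-1} b c^{-1} = (p q1) (c b1)^{-1}. *)
Lemma frac_mul (p q b c b1 q1 : P) : (b * b1 = q * q1)%g ->
  b1.1 = [::] \/ q1.1 = [::] ->
  sgx a p.1 (p.2 * q.2^-1)%g q.1 ** sgx a b.1 (b.2 * c.2^-1)%g c.1 =
  sgx a (p * q1)%g.1 ((p * q1).2 * (c * b1).2^-1)%g (c * b1)%g.1.
Proof.
case: p q b c b1 q1 => [al g] [ga h] [de k] [si l] [x xi] [y eta].
move=> E; have E1 : de ++ act a k x = ga ++ act a h y := congr1 fst E.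
have E2 : (restr a k x * xi = restr a h y * eta)%g := congr1 snd E.
change (x = [::] \/ y = [::] ->
  sgx a al (g * h^-1)%g ga ** sgx a de (k * l^-1)%g si =
  sgx a (al ++ act a g y) (restr a g y * eta * (restr a l x * xi)^-1)%g
    (si ++ act a l x)).
case=> [x0|y0] {E}.
  subst x; rewrite act_nil cats0 restr_nil in E1 E2.
  rewrite E1 sgx_mul_catr actM actK act_nil restr_nil cats0.
  rewrite invgM; congr sgx.
  have -> : eta = ((restr a h y)^-1 * (k * xi))%g by rewrite E2 mulKg.
  by rewrite restrM restrV actK !mulgA mulgK.
subst y; rewrite act_nil cats0 restr_nil in E1 E2.
rewrite -E1 sgx_mul_catl invgM invgK actM actK act_nil cats0 restr_nil.
congr sgx; have -> : eta = (h^-1 * (restr a k x * xi))%g by rewrite E2 mulKg.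
by rewrite restrM restrV actK !invgM invgK !mulgA mulgK.
Qed.

(** Every value allowed by [sp_mul_graph] is the displayed one, and the graph is inhabited as soon
    as that value is nonzero; together these determine the choice made by [sp_mul]. *)
Lemma sp_mul_norm al g ga n de k si m :
  size al <= n + size ga -> size de <= m + size si ->
  sp_norm al g ga n ** sp_norm de k si m =
  sp_of (sgx a al g ga ** sgx a de k si) (maxn (n + size de - size si) m).
Proof.
move=> ok1 ok2; set w := sp_of _ _.
have uniq (w' : S_P P) : sp_mul_graph (sp_norm al g ga n) (sp_norm de k si m) w' -> w' = w.
  move=> [p [q [r [b [d [c [b1 [q1 [r1 [d1 [[ok3 ok4] [E1 E2]]]]]]]]]]]].
  move=> [kk [Ik [Ek1 Ek2]]] [l [Il [El1 El2]]] ->.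
  have [le3 [q' Eq]] := (sp_okP _ _ _).1 ok3.
  have [le4 [c' Ed]] := (sp_okP _ _ _).1 ok4.
  subst q d; rewrite sp_class_norm // in E1; rewrite sp_class_norm // in E2.
  have le3' := le3; have le4' := le4; rewrite size_zsM in le3'; rewrite size_zsM in le4'.
  have [Eal Eg Ega En] := sp_norm_inj ok1 le3' E1.
  have [Ede Ek Esi Em] := sp_norm_inj ok2 le4' E2.
  have Eb : (b * b1 = q' * q1)%g by apply: (@zs_mulI _ _ _ r); rewrite /= !mulgA Ek1 Ek2.
  have E : (r1 * r * b * b1 = d1 * c * (c' * b1))%g.
    by rewrite El1 -El2 !mulgA.
  rewrite E sp_class_norm; last first.
    rewrite -E -mulgA Eb !mulgA size_zsM (size_zsM (r1 * r * q')%g) leq_add2r.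
    by rewrite -mulgA size_zsM (leq_trans le3) ?leq_addl.
  (* Of the words of [r * b] and of [q], one is a prefix of the other. The generator [kk] has the
     length of the longer one, whose complement therefore has an empty word. *)
  have min : b1.1 = [::] \/ q1.1 = [::].
    have sb : size (r * b * b1)%g.1 = size kk.1 by rewrite Ek1.
    have sq : size (r * q' * q1)%g.1 = size kk.1 by rewrite Ek2.
    rewrite !size_zsM in sb sq.
    have /orP[pre|pre] := right_ideal_cap_comparable Ik.
      have := right_ideal_capl pre; rewrite setIC Ik => /right_ideal_size.
      rewrite !size_zsM => sk; right; apply/nilP; rewrite /nilp; lia.
    have := right_ideal_capl pre; rewrite Ik => /right_ideal_size.
    rewrite !size_zsM => sk; left; apply/nilP; rewrite /nilp; lia.
  rewrite /w Eal Eg Ega Ede Ek Esi (frac_mul p c' Eb min) /=; congr sp_norm.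
  (* The degree is |d1 c| = |l| - |c'|, where |l| is the maximum of n + |de| and m + |si|, and |c'|
     = |si|. *)
  have := left_ideal_capE rec_a Il.
  have : size (d1 * (c * c'))%g.1 = size l.1 by rewrite El2.
  rewrite !size_zsM; lia.
have ex : w <> None -> exists w' : S_P P, sp_mul_graph (sp_norm al g ga n) (sp_norm de k si m) w'.
  move=> wn.
  pose p := zs a al g; pose r := zs a (nseq n letter) 1%g.
  pose q := zs a (nseq n letter ++ ga) 1%g.
  pose b := zs a de k; pose c := zs a (nseq m letter) 1%g.
  pose d := zs a (nseq m letter ++ si) 1%g.
  have [r1 [d1 [l [Il [El1 El2]]]]] := left_ideal_cap rec_a (r * b)%g d.
  have [b1 [q1 [kk [Ik Ek]]]] : exists b1 q1 kk,
      right_ideal (r * b)%g `&` right_ideal q = right_ideal kk /\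
      (r * b * b1 = kk /\ q * q1 = kk)%g.
    have rb : (r * b)%g.1 = nseq n letter ++ de by rewrite zsM /= act1.
    have [[v Ev]|[v Ev]|[n1 n2]] := prefix_cases ga de.
    - have pre : prefix q.1 (r * b)%g.1 by rewrite rb /q /= Ev catA prefix_prefix.
      have [q1 _ E] := (right_idealP _ _).2 pre.
      exists 1%g, q1, (r * b)%g; rewrite mulg1; split=> //.
      exact: right_ideal_capl.
    - have pre : prefix (r * b)%g.1 q.1 by rewrite rb /q /= Ev catA prefix_prefix.
      have [b1 _ E] := (right_idealP _ _).2 pre.
      exists b1, 1%g, q; rewrite mulg1; split=> //.
      by rewrite setIC; exact: right_ideal_capl.
    - by case: wn; rewrite /w sgx_mul_eq0.
  exists (sp_class (p * q1)%g (r1 * r * b * b1)%g (d1 * c)%g).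
  exists p, q, r, b, d, c, b1, q1, r1, d1; split=> //.
  - by split; exact: sp_norm_ok.
  - by exists kk.
  - by exists l; rewrite -mulgA.
(* When [w] is zero the graph may be empty, and the default [None] of [xget] is then the right
   value. *)
rewrite [LHS]/(sp_mul _ _).
have [/ex[w' gr]|/contrapT wn] := pselect (w <> None).
  by apply: uniq; apply: (xgetPex None); exists w'.
by case: xgetP => [w' _ /uniq //|_]; rewrite wn.
Qed.

Lemma sp_mul0s (s : S_P P) : sm_zero ** s = sm_zero.
Proof.
rewrite [LHS]/(sp_mul _ _); case: xgetP => // w _ [p [q [r [b [d [c [b1 [q1 [r1 [d1 H]]]]]]]]]].
by case: H => -[/asboolP ok _] [+ _]; rewrite (sp_classT ok).
Qed.

Lemma sp_muls0 (s : S_P P) : s ** sm_zero = sm_zero.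
Proof.
rewrite [LHS]/(sp_mul _ _); case: xgetP => // w _ [p [q [r [b [d [c [b1 [q1 [r1 [d1 H]]]]]]]]]].
by case: H => -[_ /asboolP ok] [_ +]; rewrite (sp_classT ok).
Qed.

Lemma sp_star0 : (sm_zero : S_P P)^*s = sm_zero.
Proof.
rewrite [LHS]/(sp_star _); case: xgetP => // w _ [p [q [r [p1 [r1 [/asboolP ok + _ _]]]]]].
by rewrite (sp_classT ok).
Qed.

(** The new degree is |p1| where q = p1 p; the side condition makes the subtraction exact. *)
Lemma sp_star_norm al g ga n : size al <= n + size ga ->
  (sp_norm al g ga n)^*s = sp_norm ga g^-1%g al (n + size ga - size al).
Proof.
move=> ok1; set w := RHS.
have uniq (w' : S_P P) : sp_star_graph (sp_norm al g ga n) w' -> w' = w.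
  move=> [p [q [r [p1 [r1 [ok2 E [E1 E2] ->]]]]]].
  have [le _] := (sp_okP _ _ _).1 ok2; rewrite E1 in le E.
  rewrite sp_class_norm // in E.
  have le' := le; rewrite size_zsM in le'.
  have [Eal Eg Ega En] := sp_norm_inj ok1 le' E.
  rewrite E2 sp_class_norm -?E2 ?E1 ?size_zsM ?leq_addl //.
  rewrite /w Eal Eg Ega En invgM invgK; congr sp_norm.
  have : size (r * r1)%g.1 = size (p1 * p)%g.1 by rewrite -E1 E2.
  rewrite !size_zsM; lia.
rewrite [LHS]/(sp_star _); apply: uniq; apply: (xgetPex None).
have ok := sp_norm_ok g ok1; have [_ [p1 _ E]] := ok.
exists (sp_class (zs a ga 1%g) (zs a (nseq n letter ++ ga) 1%g) p1).
exists (zs a al g), (zs a (nseq n letter ++ ga) 1%g), (zs a (nseq n letter) 1%g), p1.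
exists (zs a ga 1%g); split=> //; split=> //.
by rewrite zsM act1 restr1 mulg1.
Qed.

Lemma sp_one_norm : (sm_one : S_P P) = sp_norm [::] 1%g [::] 0.
Proof. by []. Qed.

Lemma sp_A_norm al : sp_A a al = sp_norm al 1%g al 0.
Proof.
have := @sp_class_norm (zs a al 1%g) 1%g (zs a al 1%g).
by rewrite mul1g invg1 mulg1; apply.
Qed.

Lemma sp_B_norm be : sp_B a be = sp_norm [::] 1%g [::] (size be).
Proof.
have := @sp_class_norm 1%g (zs a be 1%g) 1%g.
by rewrite mulg1 invg1 mulg1; apply.
Qed.

Lemma sp_diag_norm al g : sp_diag (zs a al g) = sp_norm al g [::] (size al).
Proof.
have := @sp_class_norm (zs a al g) (zs a al g) 1%g.
by rewrite mulg1 invg1 mulg1; apply.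
Qed.

(** Single-valued by [sp_norm_inj]; the default is the value taken at zero. *)
Definition sp_coord (s : S_P P) : S_GX a * nat :=
  xget (None, 0) [set c | exists al g ga n,
    [/\ size al <= n + size ga, s = sp_norm al g ga n & c = (sgx a al g ga, n)]].

Definition sp_phi (s : S_P P) : S_GX a := (sp_coord s).1.

Definition sp_deg (s : S_P P) : nat := (sp_coord s).2.

Lemma sp_coord_norm al g ga n : size al <= n + size ga ->
  sp_coord (sp_norm al g ga n) = (sgx a al g ga, n).
Proof.
move=> ok; rewrite /sp_coord; case: xgetP => [c _|/(_ (sgx a al g ga, n))[]]; last first.
  by exists al, g, ga, n.
move=> [be [h [de [m [ok' E ->]]]]].
by have [-> -> -> ->] := sp_norm_inj ok ok' E.
Qed.

Lemma sp_phi_norm al g ga n : size al <= n + size ga ->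
  sp_phi (sp_norm al g ga n) = sgx a al g ga.
Proof. by move=> ok; rewrite /sp_phi sp_coord_norm. Qed.

Lemma sp_deg_norm al g ga n : size al <= n + size ga ->
  sp_deg (sp_norm al g ga n) = n.
Proof. by move=> ok; rewrite /sp_deg sp_coord_norm. Qed.

Lemma sp_phi0 : sp_phi sm_zero = sm_zero.
Proof.
rewrite /sp_phi /sp_coord; case: xgetP => // c _ [al [g [ga [n [ok + _]]]]].
by have /asboolP ok' := sp_norm_ok g ok; rewrite /sp_norm (sp_classT ok').
Qed.

(** The side condition of normal forms is stable under products, so [sp_phi] and [sp_deg] can be
    read off the formula of [sp_mul_norm]. *)
Lemma sp_of_ok al g ga n de k si m :
  size al <= n + size ga -> size de <= m + size si ->
  if sgx a al g ga ** sgx a de k si is Some (be, _, ep)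
  then size be <= maxn (n + size de - size si) m + size ep else true.
Proof.
move=> ok1 ok2.
have [[w E]|[w E]|[n1 n2]] := prefix_cases ga de; last by rewrite sgx_mul_eq0.
  by rewrite E sgx_mul_catr /= !size_cat act_size; lia.
by rewrite E sgx_mul_catl /= !size_cat act_size; move: ok1; rewrite E size_cat; lia.
Qed.

Lemma sp_phiM s t : sp_phi (s ** t) = sp_phi s ** sp_phi t.
Proof.
have [->|[al [g [ga [n [ok1 ->]]]]]] := sp_cases s; first by rewrite sp_mul0s !sp_phi0.
have [->|[de [k [si [m [ok2 ->]]]]]] := sp_cases t.
  by rewrite sp_muls0 !sp_phi0 sp_phi_norm.
rewrite sp_mul_norm // !sp_phi_norm //; have := @sp_of_ok _ g _ _ _ k _ _ ok1 ok2.
case: (sgx a al g ga ** sgx a de k si) => [[[be h] ep]|] ok /=; last exact: sp_phi0.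
exact: sp_phi_norm.
Qed.

Lemma sp_phi_star s : sp_phi s^*s = (sp_phi s)^*s.
Proof.
have [->|[al [g [ga [n [ok1 ->]]]]]] := sp_cases s; first by rewrite sp_star0 !sp_phi0.
by rewrite sp_star_norm // !sp_phi_norm //; lia.
Qed.

Lemma sp_phi_hom : star_hom0 sp_phi.
Proof. by split; [exact: sp_phiM|exact: sp_phi_star|exact: sp_phi0]. Qed.

(** The number j is shifted so that j + |w| is invariant. The side condition |al| <= n + |ga| keeps
    the shifted number nonnegative for j >= n, and the least admissible j recovers the degree. *)
Definition sp_bij (s : S_P P) (x y : seq X * nat) : Prop :=
  [/\ sgx_rel (sp_phi s) x.1 y.1, sp_deg s <= x.2 & x.2 + size x.1 = y.2 + size y.1].

Lemma sp_bijE s w j w' j' : sp_bij s (w, j) (w', j') =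
  [/\ sgx_rel (sp_phi s) w w', sp_deg s <= j & j + size w = j' + size w'].
Proof. by []. Qed.

Lemma sp_bij_inj s t : (forall x y, sp_bij s x y <-> sp_bij t x y) -> s = t.
Proof.
wlog ts : / forall s t, (forall x y, sp_bij s x y <-> sp_bij t x y) ->
    sp_phi s = sp_phi t -> sp_deg s <= sp_deg t -> s = t.
  apply=> {}s {}t E Ephi le.
  have [s0|[al [g [ga [n [ok1 E1]]]]]] := sp_cases s;
  have [t0|[de [k [si [m [ok2 E2]]]]]] := sp_cases t; first by rewrite s0 t0.
  - by move: Ephi; rewrite s0 sp_phi0 E2 sp_phi_norm.
  - by move: Ephi; rewrite t0 sp_phi0 E1 sp_phi_norm.
  (* At the shortest word and the least number in the domain of [s], being in the domain of [t]
     bounds the degree of [t]. *)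
  have [|_ + _] := (E (ga, n) (al, n + size ga - size al)).1.
    rewrite /sp_bij E1 sp_phi_norm // sp_deg_norm //=; split=> //; last by lia.
    by have := sgx_rel_base a al g ga [::]; rewrite act_nil !cats0.
  move: Ephi le; rewrite E1 E2 !sp_phi_norm // !sp_deg_norm //= => -[<- <- <-] nm mn.
  by congr sp_norm; lia.
move=> E; have Ephi : sp_phi s = sp_phi t.
  (* This [j] exceeds both degrees, and the summand |w'| makes the subtraction below exact. *)
  apply: sgx_rel_inj => w w'; pose j := sp_deg s + sp_deg t + size w'.
  have := E (w, j) (w', j + size w - size w'); rewrite /sp_bij /=.
  have jE : j + size w = j + size w - size w' + size w' by rewrite /j; lia.
  have [ds dt] : sp_deg s <= j /\ sp_deg t <= j by rewrite /j; lia.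
  by move=> [st ts']; split=> r; [have [] := st (And3 r ds jE)|have [] := ts' (And3 r dt jE)].
have [le|/ltnW le] := leqP (sp_deg s) (sp_deg t); first exact: ts.
by apply/esym/ts => // x y; rewrite E.
Qed.

Lemma sp_bij_repr : partial_bij_repr sp_bij.
Proof.
have R := sgx_rel_repr a; split; first exact: sp_bij_inj.
- move=> s t [w j] [w' j']; rewrite sp_bijE sp_phiM; split.
    move=> [/(pb_mul R)[z tz sz] dj E].
    have [s0|[al [g [ga [n [ok1 E1]]]]]] := sp_cases s; first by rewrite s0 sp_phi0 in sz.
    have [t0|[de [k [si [m [ok2 E2]]]]]] := sp_cases t; first by rewrite t0 sp_phi0 in tz.
    have nz : sgx_rel (sgx a al g ga ** sgx a de k si) w w'.
      apply/(pb_mul R); exists z; first by rewrite E2 sp_phi_norm in tz.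
      by rewrite E1 sp_phi_norm in sz.
    move: dj nz; rewrite E1 E2 sp_mul_norm //.
    have := @sp_of_ok _ g _ _ _ k _ _ ok1 ok2.
    case: (sgx a al g ga ** sgx a de k si) => [[[be h] ep]|] //= ok.
    rewrite sp_deg_norm // => dj _.
    move: tz; rewrite E2 sp_phi_norm // => -[v Ew Ez].
    have sw := congr1 size Ew; have sz' := congr1 size Ez.
    rewrite !size_cat ?act_size in sw sz'.
    (* Invariance forces this number, equal to j + |si| - |de|. That [s] is defined there means n +
       |de| - |si| <= j, the first term of the maximum in the product formula. *)
    exists (z, j + size w - size z); rewrite sp_bijE ?sp_phi_norm ?sp_deg_norm //.
      by split; [exists v| |]; rewrite // -?Ew -?Ez; lia.
    by split; [rewrite E1 sp_phi_norm in sz| |]; rewrite //; lia.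
  move=> [[z i]]; rewrite !sp_bijE => -[tz di E1] [sz dj E2]; split; last by lia.
    by apply/(pb_mul R); exists z.
  have [s0|[al [g [ga [n [ok1 Es]]]]]] := sp_cases s; first by rewrite s0 sp_phi0 in sz.
  have [t0|[de [k [si [m [ok2 Et]]]]]] := sp_cases t; first by rewrite t0 sp_phi0 in tz.
  have nz : sgx_rel (sgx a al g ga ** sgx a de k si) w w'.
    apply/(pb_mul R); exists z; first by rewrite Et sp_phi_norm in tz.
    by rewrite Es sp_phi_norm in sz.
  move: nz; rewrite Es Et sp_mul_norm //.
  have := @sp_of_ok _ g _ _ _ k _ _ ok1 ok2.
  case: (sgx a al g ga ** sgx a de k si) => [[[be h] ep]|] //= ok _.
  move: tz di dj; rewrite Es Et sp_phi_norm // !sp_deg_norm // => -[v Ew Ez].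
  have sw := congr1 size Ew; have sz' := congr1 size Ez.
  rewrite !size_cat ?act_size in sw sz'; lia.
- move=> s [w j] [w' j']; rewrite !sp_bijE sp_phi_star.
  have [s0|[al [g [ga [n [ok1 Es]]]]]] := sp_cases s.
    by rewrite s0 sp_star0 sp_phi0; split; case.
  rewrite Es sp_star_norm // !sp_deg_norm //; last by lia.
  have S' := pb_star R (sp_phi (sp_norm al g ga n)) w w'.
  split=> -[h1 h2 h3].
    have {}h1 := S'.1 h1; split=> //.
    move: h1; rewrite sp_phi_norm // => -[v Ew Ez].
    have sw := congr1 size Ew; have sz' := congr1 size Ez.
    rewrite !size_cat ?act_size in sw sz'; lia.
  split; [exact: S'.2| |by []].
  move: h1; rewrite sp_phi_norm // => -[v Ew Ez].
  have sw := congr1 size Ew; have sz' := congr1 size Ez.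
  rewrite !size_cat ?act_size in sw sz'; lia.
- move=> [w j] [w' j']; rewrite /sp_bij sp_one_norm sp_phi_norm // sp_deg_norm //=.
  split=> [[/(pb_one R) -> _ /addIn -> //]|[-> ->]]; split=> //.
  exact/(pb_one R).
- move=> s [w j] [w1 j1] [w2 j2] [/= h1 _ E1] [/= h2 _ E2].
  have E := pb_fun R h1 h2; rewrite E in E1 *; congr (_, _).
  by apply/(@addIn (size w2)); rewrite -E1 -E2.
Qed.

Lemma sp_inverse_monoid : inverse_monoid (S_P P).
Proof. exact: pb_inverse_monoid sp_bij_repr. Qed.

Definition sp_idem al n : S_P P := sp_norm al 1%g al n.

Lemma sp_idemE al be : sp_A a al ** sp_B a be = sp_idem al (size be).
Proof.
rewrite sp_A_norm sp_B_norm sp_mul_norm ?leq_addl //.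
by rewrite [sgx _ _ _ _ ** _](im_mul1r (sgx_inverse_monoid a)) /= max0n.
Qed.

Lemma sp_idem_phi s : idem (sp_phi s) -> s = sm_zero \/ exists al n, s = sp_idem al n.
Proof.
have [->|[al [g [ga [n [ok1 ->]]]]]] := sp_cases s; first by left.
rewrite sp_phi_norm // => /(ti_idemP (sgx_tree_idempotents a))[//|[be [m [-> -> ->]]]].
by right; exists be, n.
Qed.

Lemma sp_tree_idempotents : tree_idempotents sp_idem.
Proof.
have TI := sgx_tree_idempotents a.
have okI al n : size al <= n + size al by rewrite leq_addl.
have phiE al n : sp_phi (sp_idem al n) = sgx_idem a al n by rewrite sp_phi_norm.
have mulE al be m n : sp_idem al m ** sp_idem be n =
    sp_of (sgx_idem a al 0 ** sgx_idem a be 0) (maxn m n).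
  by rewrite sp_mul_norm // addnK.
have mul al be m n : prefix be al -> sp_idem al m ** sp_idem be n = sp_idem al (maxn m n).
  by move=> p; have [k E] := ti_mul TI 0 0 p; rewrite mulE E.
have mulC al be m n : sp_idem al m ** sp_idem be n = sp_idem be n ** sp_idem al m.
  by rewrite !mulE (ti_mulC TI) maxnC.
split=> //.
- move=> s; split=> [ss|[->|[al [n ->]]]].
  + by apply: sp_idem_phi; rewrite /idem -sp_phiM ss.
  + exact: sp_mul0s.
  + by rewrite /idem mul ?maxnn // prefix_refl.
- by move=> al n E; have := phiE al n; rewrite E sp_phi0.
- by move=> al be m n /sp_norm_inj[].
- by move=> al be m n p; exists (maxn m n); exact: mul.
- by move=> al be m n h1 h2; rewrite mulE (ti_mul_eq0 TI).
- exact: sp_mul0s.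
- exact: sp_muls0.
Qed.

Lemma sp_pointE x : sp_point a x = tree_point sp_idem x.
Proof.
apply/funext => s; apply/asboolP/asboolP => -[m].
  by move=> [be ->]; exists m, (size be); rewrite sp_idemE.
by move=> [n ->]; exists m, (nseq n letter); rewrite sp_idemE size_nseq.
Qed.

Lemma sp_point_phi x : sp_point a x = pull_idem sp_phi (sgx_point a x).
Proof.
rewrite sp_pointE sgx_pointE; apply/funext => s; apply/asboolP/asboolP.
  by move=> [m [n ->]]; exists m, n; rewrite sp_phi_norm // leq_addl.
have [->|[al [g [ga [n [ok1 ->]]]]]] := sp_cases s.
  by rewrite sp_phi0 => -[m [n /esym /(ti_neq0 (sgx_tree_idempotents a))]].
by rewrite sp_phi_norm // => -[m [_ [-> -> ->]]]; exists m, n.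
Qed.

(** Degree |al| meets the side condition whatever [ga] is. The section is not multiplicative:
    degrees of products may differ. *)
Definition sp_lift (t : S_GX a) : S_P P :=
  if t is Some (al, g, ga) then sp_norm al g ga (size al) else None.

Lemma sp_liftK : cancel sp_lift sp_phi.
Proof.
by case=> [[[al g] ga]|]; [rewrite /sp_lift sp_phi_norm ?leq_addr|exact: sp_phi0].
Qed.

Lemma sp_norm_mul_B al g ga n m : size al <= n + size ga ->
  sp_norm al g ga n ** sp_idem [::] m = sp_norm al g ga (maxn n m).
Proof.
move=> ok; rewrite sp_mul_norm //.
by rewrite [sgx _ _ _ _ ** _](im_mul1r (sgx_inverse_monoid a)) /= addn0 subn0.
Qed.

Lemma sp_phi_ker u v : sp_phi u = sp_phi v ->
  exists b, [/\ idem b, sp_phi b = sm_one & u ** b = v ** b].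
Proof.
move=> E; exists (sp_idem [::] (maxn (sp_deg u) (sp_deg v))); split.
- by apply/(ti_idemP sp_tree_idempotents); right; exists [::], (maxn (sp_deg u) (sp_deg v)).
- by rewrite sp_phi_norm.
have [u0|[al [g [ga [n [ok1 Eu]]]]]] := sp_cases u;
have [v0|[de [k [si [m [ok2 Ev]]]]]] := sp_cases v.
- by rewrite u0 v0.
- by move: E; rewrite u0 Ev sp_phi0 sp_phi_norm.
- by move: E; rewrite v0 Eu sp_phi0 sp_phi_norm.
move: E; rewrite Eu Ev !sp_phi_norm // !sp_deg_norm // => -[E1 E2 E3].
by subst; rewrite !sp_norm_mul_B //; congr sp_norm; lia.
Qed.

Lemma sp_phi_generator al g ga be :
  sp_phi (sp_diag (zs a al g) ** (sp_diag (zs a ga 1%g))^*s ** sp_B a be) = sgx a al g ga.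
Proof.
rewrite !sp_phiM sp_phi_star !sp_diag_norm sp_B_norm !sp_phi_norm ?leq_addr //.
rewrite [LHS](im_mul1r (sgx_inverse_monoid a)).
have := sgx_mul_catr a al g [::] [::] 1^-1%g ga.
by rewrite act_nil restr_nil !cats0 => E; rewrite [LHS]E invg1 mulg1.
Qed.

End SpNormal.

(** * Tight representations and Nekrashevych families *)

Section CStarAlgebraTheory.
Local Open Scope ring_scope.
Variables (K : numClosedFieldType) (A : cstarAlgType K).
Implicit Types x y z p q : A.

Lemma cmul0l x : 0 *c x = 0 :> A.
Proof. by apply: (addrI (0 *c x)); rewrite -cmulDl !addr0. Qed.

Lemma cmul0r x : x *c 0 = 0 :> A.
Proof. by apply: (addrI (x *c 0)); rewrite -cmulDr !addr0. Qed.

Lemma cmulNl x y : (- x) *c y = - (x *c y).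
Proof. by apply: (addrI (x *c y)); rewrite -cmulDl !subrr cmul0l. Qed.

Lemma cmulNr x y : x *c (- y) = - (x *c y).
Proof. by apply: (addrI (x *c y)); rewrite -cmulDr !subrr cmul0r. Qed.

Lemma cmul_suml (I : Type) (r : seq I) (F : I -> A) x :
  (\sum_(i <- r) F i) *c x = \sum_(i <- r) F i *c x.
Proof. by apply: (big_morph (fun y => y *c x)) => [y z|]; rewrite ?cmulDl ?cmul0l. Qed.

Lemma cmul_sumr (I : Type) (r : seq I) (F : I -> A) x :
  x *c (\sum_(i <- r) F i) = \sum_(i <- r) x *c F i.
Proof. by apply: (big_morph (cmul x)) => [y z|]; rewrite ?cmulDr ?cmul0r. Qed.

Lemma cstar0 : (0 : A)^*c = 0.
Proof. by apply: (addrI (0 : A)^*c); rewrite -cstarD !addr0. Qed.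

Lemma cstar1 : (1c : A)^*c = 1c.
Proof. by have := cstarM (1c : A)^*c 1c; rewrite cmul1r !cstarK cmul1r => <-. Qed.

Lemma proj_join0 x : proj_join x 0 = x.
Proof. by rewrite /proj_join cmul0r addr0 subr0. Qed.

Lemma proj_joinMl x y z : proj_join x y *c z = x *c z + y *c z - x *c (y *c z).
Proof. by rewrite /proj_join !cmulDl cmulNl cmulA. Qed.

Lemma proj_joinMr x y z : z *c proj_join x y = z *c x + z *c y - z *c x *c y.
Proof. by rewrite /proj_join !cmulDr cmulNr cmulA. Qed.

Section BigJoin.
Variables (I : eqType) (q : I -> A).
Local Notation J r := (\big[@proj_join K A/0]_(i <- r) q i).

Lemma big_join_mul_id (r : seq I) p : (forall i, q i *c p = q i) -> J r *c p = J r.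
Proof.
move=> h; apply: (big_ind (fun x => x *c p = x)) => //; first exact: cmul0l.
by move=> x y xp yp; rewrite proj_joinMl xp yp.
Qed.

Lemma big_join_commute (r : seq I) p :
  (forall i, p *c q i = q i *c p) -> p *c J r = J r *c p.
Proof.
move=> h; apply: (big_ind (fun x => p *c x = x *c p)) => //.
  by rewrite cmul0l cmul0r.
move=> x y px py; rewrite proj_joinMl proj_joinMr px py; congr (_ - _).
by rewrite -cmulA py.
Qed.

(** The join of x and y is 1 - (1 - x)(1 - y), so the factor 1 - q_i, once commuted to the right,
    annihilates [p]. *)
Lemma big_join_absorb (r : seq I) i p : (forall i j, q i *c q j = q j *c q i) ->
  i \in r -> q i *c p = p -> J r *c p = p.
Proof.
move=> C + ip; elim: r => // j r IH; rewrite inE big_cons proj_joinMl.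
case/predU1P => [<-|/IH ->]; last by rewrite addrAC subrr add0r.
have E : q i *c J r = J r *c q i by apply: big_join_commute.
by rewrite cmulA E -cmulA ip addrK.
Qed.

Lemma big_join_orthogonal (r : seq I) : uniq r ->
  (forall i j, i != j -> q i *c q j = 0) -> J r = \sum_(i <- r) q i.
Proof.
move=> + O; elim: r => [|j r IH] /=; first by rewrite !big_nil.
move=> /andP[jr ur]; rewrite !big_cons IH // /proj_join cmul_sumr.
have -> : \sum_(i <- r) q j *c q i = 0; last by rewrite subr0.
rewrite big_seq big1 // => i ir; apply: O.
by apply: contraNneq jr => ->.
Qed.

End BigJoin.

End CStarAlgebraTheory.

Section StarMorphisms.
Local Open Scope ring_scope.
Variable K : numClosedFieldType.

Lemma star_morph_id (A : cstarAlgType K) : star_morph (@id A).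
Proof. by []. Qed.

Lemma star_morph_comp (A B C : cstarAlgType K) (h : A -> B) (k : B -> C) :
  star_morph h -> star_morph k -> star_morph (k \o h).
Proof.
move=> [h1 h2 h3 h4] [k1 k2 k3 k4]; split=> [c x y|x y||x] /=.
- by rewrite h1 k1.
- by rewrite h2 k2.
- by rewrite h3 k3.
- by rewrite h4 k4.
Qed.

Lemma star_morph0 (A B : cstarAlgType K) (h : A -> B) : star_morph h -> h 0 = 0.
Proof.
move=> [h1 _ _ _]; have := h1 1 0 0; rewrite !scale1r addr0 => /esym E.
by apply: (addrI (h 0)); rewrite addr0.
Qed.

End StarMorphisms.

(** * Families and tight representations of S_(G,X) *)

Section NekrashevychFamilies.
Local Open Scope ring_scope.
Variables (K : numClosedFieldType) (A : cstarAlgType K).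
Variables (G : groupType) (X : finType) (a : self_similar_action G X).
Implicit Types (al be ga de w : seq X) (g k : G).

Section Family.
Variables (t : X -> A) (v : G -> A).

Definition word_isometry w : A := foldr (fun x b => t x *c b) 1c w.
Local Notation tw := word_isometry.

Definition sgx_family (s : S_GX a) : A :=
  if s is Some (al, g, ga) then tw al *c v g *c (tw ga)^*c else 0.

Lemma sgx_familyE al g ga : sgx_family (sgx a al g ga) = tw al *c v g *c (tw ga)^*c.
Proof. by []. Qed.

Lemma word_isometry_cat al be : tw (al ++ be) = tw al *c tw be.
Proof. by elim: al => [|x al IH] /=; rewrite ?cmul1l // IH cmulA. Qed.

Hypothesis fam : nekrashevych_family a t v.

Let tK x : (t x)^*c *c t x = 1c. Proof. by case: fam => -[]. Qed.
Let vM g k : v g *c v k = v (g * k)%g. Proof. by case: fam => _ _ _ [] + _ _; apply. Qed.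
Let v_star g : (v g)^*c = v g^-1%g. Proof. by case: fam => _ _ _ [] _ + _; apply. Qed.

Lemma family_unitary1 : v 1%g = 1c.
Proof.
have [[_ /(_ 1%g)[u1 _]] _ _ _ _] := fam.
have := congr1 (cmul (v 1%g)^*c) (vM 1%g 1%g).
by rewrite cmulA u1 cmul1l mulg1 u1.
Qed.

Lemma word_isometryK w : (tw w)^*c *c tw w = 1c.
Proof.
elim: w => [|x w IH] /=; first by rewrite cstar1 cmul1l.
by rewrite cstarM cmulA -(cmulA (tw w)^*c) tK cmul1r.
Qed.

Lemma unitary_word g w : v g *c tw w = tw (act a g w) *c v (restr a g w).
Proof.
elim: w g => [|x w IH] g; first by rewrite act_nil restr_nil /= cmul1l cmul1r.
have sz : size (act a g [:: x]) = 1%N by rewrite act_size.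
case E : (act a g [:: x]) sz => [|y []] // _.
have [_ _ _ _ /(_ _ _ _ E) ux] := fam.
rewrite -cat1s act_cat restr_cat E /= cmulA ux -cmulA IH.
by rewrite cmulA.
Qed.

Lemma word_star_unitary w k :
  (tw w)^*c *c v k = v (restr a k^-1 w)^-1%g *c (tw (act a k^-1%g w))^*c.
Proof.
have := congr1 cstar (unitary_word k^-1%g w).
by rewrite !cstarM !v_star invgK.
Qed.

Lemma word_isometry_orthogonal al be : ~~ prefix al be -> ~~ prefix be al ->
  (tw al)^*c *c tw be = 0.
Proof.
elim: al be => [|x al IH] [|y be] //=; rewrite eq_sym.
have [->|xy] := eqVneq y x; last first.
  move=> _ _; have [_ _ /(_ x y)] := fam; rewrite eq_sym => /(_ xy) O _ _.
  by rewrite cstarM -cmulA (cmulA (t x)^*c) O cmul0l cmul0r.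
move=> h1 h2; rewrite cstarM -cmulA (cmulA (t x)^*c) tK cmul1l.
exact: IH.
Qed.

Lemma sgx_familyM s s' : sgx_family (s ** s') = sgx_family s *c sgx_family s'.
Proof.
case: s s' => [[[al g] ga]|] [[[de k] si]|]; rewrite ?cmul0l ?cmul0r //.
rewrite -!/(sgx a _ _ _).
have [[w ->]|[w ->]|[n1 n2]] := prefix_cases ga de.
- rewrite sgx_mul_catr !sgx_familyE !word_isometry_cat -vM.
  rewrite -!cmulA; congr (_ *c _).
  rewrite [in RHS](cmulA (tw ga)^*c) word_isometryK cmul1l.
  by rewrite [in RHS](cmulA (v g)) unitary_word -!cmulA.
- rewrite sgx_mul_catl !sgx_familyE !word_isometry_cat -vM.
  rewrite !cstarM -!cmulA; congr (_ *c (_ *c _)).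
  rewrite [in RHS](cmulA (tw de)^*c) word_isometryK cmul1l.
  by rewrite [in RHS](cmulA (tw w)^*c) word_star_unitary -!cmulA.
- rewrite sgx_mul_eq0 // !sgx_familyE -!cmulA (cmulA (tw ga)^*c).
  by rewrite word_isometry_orthogonal // cmul0l !cmul0r.
Qed.

Lemma sgx_family_star s : sgx_family s^*s = (sgx_family s)^*c.
Proof.
case: s => [[[al g] ga]|]; last by rewrite /= cstar0.
have -> : (Some (al, g, ga) : S_GX a)^*s = sgx a ga g^-1%g al by [].
by rewrite !sgx_familyE !cstarM cstarK v_star cmulA.
Qed.

Lemma sgx_family_idem al n : sgx_family (sgx_idem a al n) = tw al *c (tw al)^*c.
Proof. by rewrite /sgx_idem sgx_familyE family_unitary1 cmul1r. Qed.

Lemma word_projection_split al :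
  tw al *c (tw al)^*c = \sum_(x : X) tw (al ++ [:: x]) *c (tw (al ++ [:: x]))^*c.
Proof.
have [_ sum1 _ _ _] := fam.
rewrite -[X in X *c _ = _]cmul1r -sum1 cmul_sumr cmul_suml; apply: eq_bigr => x _.
by rewrite word_isometry_cat /= cmul1r cstarM !cmulA.
Qed.

(** Iterating the splitting by one letter, the projection of [be] is the sum of those of its
    extensions by k letters. *)
Lemma word_projection_absorb (p : A) (k : nat) be :
  (forall w, size w = k -> p *c sgx_family (sgx_idem a (be ++ w) 0) =
                           sgx_family (sgx_idem a (be ++ w) 0)) ->
  p *c sgx_family (sgx_idem a be 0) = sgx_family (sgx_idem a be 0).
Proof.
elim: k be => [|k IH] be h; first by rewrite -[be]cats0; apply: h.
rewrite !sgx_family_idem word_projection_split cmul_sumr; apply: eq_bigr => x _.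
rewrite -(sgx_family_idem _ 0); apply: IH => w wk.
by rewrite -catA; apply: h; rewrite /= wk.
Qed.

Lemma sgx_family_tight : tight_repr sgx_family.
Proof.
have TI := sgx_tree_idempotents a; have IM := sgx_inverse_monoid a.
split=> //; [|exact: sgx_familyM|exact: sgx_family_star|].
  by rewrite /= family_unitary1 cstar1 !cmul1l.
move=> e n c /(ti_idemP TI)[->|[al [m ->]]] [idc cov].
  apply: (big_ind (fun x => x = 0)) => // [x y -> ->|i _]; first exact: proj_join0.
  by have [_ <-] := idc i; rewrite (ti_muls0 TI).
have -> : sgx_idem a al m = sgx_idem a al 0 by [].
set J := \big[_/_]_(i < n) _.
have JE : J *c sgx_family (sgx_idem a al 0) = J.
  by apply: big_join_mul_id => i; rewrite -sgx_familyM; have [_ ->] := idc i.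
(* Beyond the maximal length in the cover, a word that meets some [c i] lies below it, so each
   extension of [al] by that many letters is absorbed by the join. *)
rewrite -[LHS]JE; pose len (s : S_GX a) := if s is Some (be, _, _) then size be else 0%N.
apply: (@word_projection_absorb _ (\max_(i < n) len (c i))) => w wE.
have idw : idem (sgx_idem a (al ++ w) 0).
  by apply/(ti_idemP TI); right; exists (al ++ w), 0%N.
have lew : idem_le (sgx_idem a (al ++ w) 0) (sgx_idem a al m).
  by rewrite /idem_le /sgx_idem sgx_mul_catl invg1 act1 restr1 invg1 mulg1.
have [i ci] := cov _ idw (@ti_neq0 _ _ _ TI _ _) lew.
apply: (big_join_absorb (i := i)); last 1 first.
- rewrite -sgx_familyM; congr sgx_family.
  have [/(ti_idemP TI)[c0|[be [l cE]]] _] := idc i.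
    by case: ci; rewrite c0 (ti_mul0s TI).
  have le : (size be <= size (al ++ w))%N.
    rewrite size_cat wE; apply: leq_trans (leq_addl _ _).
    by have := @leq_bigmax _ (fun i => len (c i)) i; rewrite cE.
  rewrite cE in ci *; have [[u Eu]|[u Eu]|[n1 n2]] := prefix_cases be (al ++ w).
  + by rewrite Eu /sgx_idem sgx_mul_catr act1 restr1 mulg1.
  + have <- : al ++ w = be by apply: prefix_size_eq le; rewrite Eu prefix_prefix.
    exact: idw.
  + by case: ci; rewrite (ti_mul_eq0 TI).
- move=> i1 i2; rewrite -!sgx_familyM (im_idemC IM) //; first by case: (idc i1).
  by case: (idc i2).
- exact: mem_index_enum.
Qed.

End Family.

Section TightRepr.
Variables (letter : X) (pi : S_GX a -> A).
Hypothesis pi_tight : tight_repr pi.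

Let piM s t : pi (s ** t) = pi s *c pi t. Proof. by case: pi_tight. Qed.
Let pi_star s : pi s^*s = (pi s)^*c. Proof. by case: pi_tight. Qed.
Let pi1 : pi sm_one = 1c. Proof. by case: pi_tight. Qed.
Let pi0 : pi sm_zero = 0. Proof. by case: pi_tight. Qed.

Lemma sgx_isometry_mul x y : (sgx a [:: x] 1%g [::])^*s ** sgx a [:: y] 1%g [::] =
  if x == y then sm_one else sm_zero.
Proof.
have -> : (sgx a [:: x] 1%g [::])^*s = sgx a [::] 1^-1%g [:: x] by [].
rewrite invg1; have [->|xy] := eqVneq.
  have := sgx_mul_catr a [::] 1%g [:: y] [::] 1%g [::].
  by rewrite act1 restr1 mulg1.
by rewrite sgx_mul_eq0 //= ?(eq_sym y) (negbTE xy).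
Qed.

Lemma sgx_isometry_star x :
  sgx a [:: x] 1%g [::] ** (sgx a [:: x] 1%g [::])^*s = sgx_idem a [:: x] 0.
Proof.
have -> : (sgx a [:: x] 1%g [::])^*s = sgx a [::] 1^-1%g [:: x] by [].
have := sgx_mul_catr a [:: x] 1%g [::] [::] 1^-1%g [:: x].
by rewrite act1 restr1 invg1 mulg1.
Qed.

Lemma sgx_unitM g k :
  sgx a [::] g [::] ** sgx a [::] k [::] = sgx a [::] (g * k)%g [::].
Proof.
by have := sgx_mul_catr a [::] g [::] [::] k [::]; rewrite act_nil restr_nil.
Qed.

Lemma tight_repr_family : nekrashevych_family a
  (fun x => pi (sgx a [:: x] 1%g [::])) (fun g => pi (sgx a [::] g [::])).
Proof.
have TI := sgx_tree_idempotents a.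
have us g : (pi (sgx a [::] g [::]))^*c = pi (sgx a [::] g^-1%g [::]) by rewrite -pi_star.
split.
- split=> [x|g]; first by rewrite -pi_star -piM sgx_isometry_mul eqxx.
  by rewrite us -!piM !sgx_unitM mulgV mulVg.
(* The one-letter idempotents cover the identity, and since they are orthogonal their join is a
   sum. *)
- have [_ _ _ _ /(_ sm_one #|X| (fun i => sgx_idem a [:: enum_val i] 0))] := pi_tight.
  rewrite pi1 => <-.
  + rewrite big_join_orthogonal ?index_enum_uniq //; last first.
      move=> i j ij; rewrite -piM (ti_mul_eq0 TI) ?pi0 //= ?andbT;
      by apply: contra_neq ij => /enum_val_inj.
    rewrite (reindex _ (onW_bij _ (@enum_val_bij X))).
    by apply: eq_bigr => i _; rewrite -pi_star -piM sgx_isometry_star.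
  + exact: (im_mul1l (sgx_inverse_monoid a)).
  split=> [i|f /(ti_idemP TI)[-> //|[al [n ->]]] _ _].
    split; first by apply/(ti_idemP TI); right; exists [:: enum_val i], 0%N.
    exact: (im_mul1r (sgx_inverse_monoid a)).
  case: al => [|x al].
    (* The idempotent of the empty word meets every letter, and X has one. *)
    exists (enum_rank letter); rewrite [_ ** _](im_mul1r (sgx_inverse_monoid a)).
    exact: (ti_neq0 TI).
  exists (enum_rank x); rewrite enum_rankK.
  have [m ->] : exists m, sgx_idem a [:: x] 0 ** sgx_idem a (x :: al) n = sgx_idem a (x :: al) m.
    by rewrite (ti_mulC TI); apply: (ti_mul TI); exact: (prefix_prefix [:: x]).
  exact: (ti_neq0 TI).
- by move=> x y xy; rewrite -pi_star -piM sgx_isometry_mul (negbTE xy) pi0.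
- by split=> [g k|g]; rewrite ?us // -piM sgx_unitM.
- move=> g x y E; rewrite -!piM; congr pi.
  have := sgx_mul_catr a [::] g [::] [:: x] 1%g [::].
  have := sgx_mul_catr a [:: y] 1%g [::] [::] (restr a g [:: x]) [::].
  by rewrite E act_nil restr_nil /= mul1g mulg1 => <- ->.
Qed.

Lemma sgx_family_of_tight s :
  sgx_family (fun x => pi (sgx a [:: x] 1%g [::])) (fun g => pi (sgx a [::] g [::])) s
  = pi s.
Proof.
case: s => [[[al g] ga]|]; last by rewrite /= pi0.
rewrite -/(sgx a al g ga) sgx_familyE.
have twE w : word_isometry (fun x => pi (sgx a [:: x] 1%g [::])) w = pi (sgx a w 1%g [::]).
  elim: w => [|x w IH] /=; first by rewrite -pi1.
  rewrite IH -piM; congr pi.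
  have := sgx_mul_catr a [:: x] 1%g [::] w 1%g [::].
  by rewrite act1 restr1 mulg1.
rewrite !twE -pi_star -!piM; congr pi.
have := sgx_mul_catr a al 1%g [::] [::] g [::]; rewrite act1 restr1 mul1g cats0 => E.
rewrite [_ ** sgx a [::] g [::]]E.
have -> : (sgx a ga 1%g [::])^*s = sgx a [::] 1^-1%g ga by [].
have := sgx_mul_catr a al g [::] [::] 1^-1%g ga.
by rewrite act_nil restr_nil invg1 mulg1 !cats0.
Qed.

End TightRepr.

End NekrashevychFamilies.

(** * Universal algebras *)

Section TightTransfer.
Variables (K : numClosedFieldType) (A : cstarAlgType K).
Variables (G : groupType) (X : finType) (a : self_similar_action G X).
Variable letter : X.
Hypothesis rec_a : recurrent a.
Local Notation S := (S_P (zappa_szep a)).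
Local Notation phi := (@sp_phi G X a letter).
Local Notation lift := (@sp_lift G X a letter).

Lemma sp_phi_eq0 (s : S) : phi s = sm_zero -> s = sm_zero.
Proof.
have [->//|[al [g [ga [n [ok ->]]]]]] := sp_cases letter rec_a s.
by rewrite sp_phi_norm.
Qed.

Lemma sp_phi_idemP (s : S) : idem (phi s) <-> idem s.
Proof.
split=> [/(sp_idem_phi rec_a) h|h]; first exact/(ti_idemP (sp_tree_idempotents letter rec_a)).
by rewrite /idem -sp_phiM // h.
Qed.

Lemma tight_repr_phi (rho : S_GX a -> A) : tight_repr rho -> tight_repr (rho \o phi).
Proof.
move=> [r1 rM rs r0 rT]; split; rewrite /comp.
- by rewrite (sp_one_norm a letter) sp_phi_norm.
- by move=> s t; rewrite sp_phiM.
- by move=> s; rewrite sp_phi_star.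
- by rewrite sp_phi0.
move=> e n c ie [cle cov]; apply: rT; first exact/sp_phi_idemP.
split=> [i|f if_ f0 le_f].
  have [ic le] := cle i; split; first exact/sp_phi_idemP.
  by rewrite /idem_le -sp_phiM // le.
have E : phi (lift f ** e) = f by rewrite sp_phiM // sp_liftK.
(* The degree of [lift f] may be smaller than that of [e]; the factor [e] brings it below [e]
   without changing its image. *)
have [|||i ci] := cov (lift f ** e).
- by apply/sp_phi_idemP; rewrite E.
- by move=> z; apply: f0; rewrite -E z sp_phi0.
- by rewrite /idem_le -(im_mulA (sp_inverse_monoid letter rec_a)) ie.
exists i => z; apply: ci; apply: sp_phi_eq0.
by rewrite sp_phiM // E.
Qed.

Variable pi : S -> A.
Hypothesis pi_tight : tight_repr pi.

Let piM s t : pi (s ** t) = pi s *c pi t. Proof. by case: pi_tight. Qed.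

(* The idempotents B_n are dense, so they act as the identity. *)
Lemma tight_repr_phi_inj u v : phi u = phi v -> pi u = pi v.
Proof.
move=> /(sp_phi_ker rec_a)[b [ib b1 E]].
have [p1 _ _ _ pT] := pi_tight.
have pb : pi b = 1c.
  rewrite -p1 -(pT sm_one 1%N (fun=> b)); last 2 first.
  - exact: (im_mul1l (sp_inverse_monoid letter rec_a)).
  - split=> [_|f _ f0 _].
      by split=> //; exact: (im_mul1r (sp_inverse_monoid letter rec_a)).
    exists ord0 => z; apply/f0/sp_phi_eq0.
    have := congr1 phi z; rewrite sp_phiM // b1 sp_phi0 // => <-.
    exact/esym/(im_mul1l (sgx_inverse_monoid a)).
  by rewrite big_ord_recl big_ord0 proj_join0.
by have := congr1 pi E; rewrite !piM pb !cmul1r.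
Qed.

(** Although [lift] is not multiplicative, [pi] depends only on images under [phi], so each
    algebraic law may be checked there. *)
Lemma tight_repr_lift : tight_repr (pi \o lift).
Proof.
have [p1 _ ps p0 pT] := pi_tight; have IM := sp_inverse_monoid letter rec_a.
have idem_lift e : idem e -> idem (lift e).
  by move=> ie; apply/sp_phi_idemP; rewrite sp_liftK.
split; rewrite /comp.
- by rewrite -p1; apply: tight_repr_phi_inj; rewrite sp_liftK.
- by move=> s t; rewrite -piM; apply: tight_repr_phi_inj; rewrite sp_phiM // !sp_liftK.
- by move=> s; rewrite -ps; apply: tight_repr_phi_inj; rewrite sp_phi_star // !sp_liftK.
- exact: p0.
move=> e n c ie [cle cov]; have iE := idem_lift _ ie.
(* The factor [lift e] puts the cover below [lift e] without a degree count. *)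
rewrite -(pT (lift e) n (fun i => lift (c i) ** lift e)) //.
  apply: eq_bigr => i _; apply: tight_repr_phi_inj.
  by rewrite sp_phiM // !sp_liftK //; have [_ ->] := cle i.
split=> [i|f if_ f0 le_f].
  have [ic le] := cle i; split; first by apply: idem_mul => //; exact: idem_lift.
  by rewrite /idem_le -(im_mulA IM) iE.
have [|||i ci] := cov (phi f).
- exact/sp_phi_idemP.
- by move=> /sp_phi_eq0.
- by rewrite /idem_le -{1}(sp_liftK letter rec_a e) -sp_phiM // le_f.
exists i => z; apply: ci; rewrite -(sp_liftK letter rec_a (c i)) -sp_phiM //.
move: z; rewrite -(im_mulA IM) (im_idemC IM iE if_) le_f => ->.
by rewrite sp_phi0.
Qed.

End TightTransfer.

Theorem theorem4p10 (R : realType) (G : groupType) (X : finType)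
    (a : self_similar_action G X) :
  (0 < #|X|)%N -> pseudo_free a -> recurrent a ->
  [/\ homeo_onto (sp_point a) (tight_spectrum (S_P (zappa_szep a))),
      homeo_onto (sgx_point a) (tight_spectrum (S_GX a)),
      exists phi : S_P (zappa_szep a) -> S_GX a,
        [/\ star_hom0 phi,
            forall (al : seq X) (g : G) (ga be : seq X),
              phi (sp_diag (zs a al g) ** (sp_diag (zs a ga 1%g))^*s
                     ** sp_B a be) = sgx a al g ga
          & exists Phi : G_tight (S_P (zappa_szep a)) -> G_tight (S_GX a),
              (forall (s : S_P (zappa_szep a)) (x : inf_word X)
                      (c : G_tight (S_P (zappa_szep a))),
                 is_germ c s (sp_point a x) ->
                 is_germ (Phi c) (phi s) (sgx_point a x)) /\
              top_groupoid_iso Phi]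
    & forall (A : cstarAlgType R[i]) (pi : S_P (zappa_szep a) -> A)
             (B : cstarAlgType R[i]) (s : X -> B) (u : G -> B),
        is_Q_ts pi -> is_O_GX a s u -> star_isomorphic A B].
Proof.
move=> /card_gt0P[letter _] _ rec_a.
have TI := sgx_tree_idempotents a; have TIP := sp_tree_idempotents letter rec_a.
have sgx_pt : sgx_point a = tree_point (sgx_idem a).
  by apply/funext => x; exact: sgx_pointE.
have sp_pt : sp_point a = tree_point (sp_idem a letter).
  by apply/funext => x; exact: sp_pointE.
split.
- by rewrite sp_pt; exact: (tree_point_homeo letter TIP).
- by rewrite sgx_pt; exact: (tree_point_homeo letter TI).
- exists (sp_phi letter); split; [exact: sp_phi_hom|exact: sp_phi_generator|].
  have [||||||||Phi [PhiP iso]] := @groupoid_iso_of_pull _ _ (sp_phi (a := a) letter) (sp_lift letter).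
  + exact: sp_inverse_monoid letter rec_a.
  + exact: sgx_inverse_monoid.
  + exact: sp_phi_hom.
  + exact: sp_liftK.
  + by move=> e /(sp_phi_idemP letter rec_a).
  + exact: sp_phi_ker.
  + move=> xi; rewrite (tight_tree_point letter TIP); split.
      move=> [x ->]; exists (sgx_point a x).
        by rewrite sgx_pt; apply/(tight_tree_point letter TI); exists x.
      by rewrite -(sp_point_phi letter rec_a) sp_pt.
    move=> [eta /(tight_tree_point letter TI)[x ->] ->]; exists x.
    by rewrite -sgx_pt -(sp_point_phi letter rec_a) sp_pt.
  + exact: sgx_tight_act_tight.
  exists Phi; split=> // s x c; rewrite (sp_point_phi letter rec_a).
  exact: PhiP.
move=> A pi B s u [pi_tight pi_univ] [su_fam su_univ].
have lift_tight := tight_repr_lift letter rec_a pi_tight.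
have [h [[h_morph hs hu] _]] := su_univ _ _ _ (tight_repr_family letter lift_tight).
have rho_tight := sgx_family_tight su_fam.
have [k [[k_morph k_pi] _]] := pi_univ _ _ (tight_repr_phi letter rec_a rho_tight).
(* As [h] is only known on generators, both sides are rewritten as words in the same Nekrashevych
   family. *)
have h_fam z : h (sgx_family s u z) = pi (sp_lift letter z).
  rewrite -[RHS](sgx_family_of_tight lift_tight z).
  have [_ hM h1 h_star] := h_morph.
  case: z => [[[al g] ga]|]; last exact: star_morph0.
  have h_word w : h (word_isometry s w) = word_isometry (h \o s) w.
    by elim: w => [|x w IH] /=; rewrite ?hM ?IH.
  rewrite /= !hM h_star !h_word hu.
  have -> : h \o s = fun x => (pi \o sp_lift letter) (sgx a [:: x] 1%g [::]).
    by apply/funext => x; rewrite /= hs.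
  by [].
exists k => //; exists h.
(* The composite and the identity solve the same universal problem, so uniqueness identifies them;
   likewise for the other composite. *)
- have [h0 [_ uniq]] := pi_univ _ _ pi_tight.
  have E1 : h0 = id by apply: uniq; split=> //; exact: star_morph_id.
  have E2 : h0 = h \o k.
    apply: uniq; split; first exact: star_morph_comp.
    move=> z; rewrite /= k_pi /= h_fam; apply: (tight_repr_phi_inj (letter := letter) rec_a pi_tight).
    by rewrite sp_liftK.
  by move=> z; have := congr1 (fun f => f z) E2; rewrite E1.
have [k0 [_ uniq]] := su_univ _ _ _ su_fam.
have E1 : k0 = id by apply: uniq; split=> //; exact: star_morph_id.
have E2 : k0 = k \o h.
  (* The isometry of a letter x corresponds to ([x], 1, empty word), hence to s_x u_1, so u_1 = 1 is
     required. *)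
  have v1 := family_unitary1 su_fam.
  apply: uniq; split; first exact: star_morph_comp.
    move=> x; rewrite [LHS](congr1 k (hs x)) [LHS]k_pi /comp sp_liftK //.
    by rewrite sgx_familyE v1 /= cstar1 !cmul1r.
  move=> g; rewrite [LHS](congr1 k (hu g)) [LHS]k_pi /comp sp_liftK //.
  by rewrite sgx_familyE /= cstar1 cmul1l cmul1r.
by move=> z; have := congr1 (fun f => f z) E2; rewrite E1.
Qed.
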